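(* Consider the following $3$-dimensional unital algebras over $\mathbb{F}_2$ with basis $1,x,y$: $A$: $x^2=y^2=xy=yx=0$; $B$: $x^2=x,\ y^2=y,\ xy=yx=0$ (functions on $\mathbb{Z}_3$); $C$: $x^2=x,\ y^2=xy=yx=0$; $D$: $x^2=y,\ y^2=x,\ xy=yx=x+y$ (isomorphic to the group algebra $\mathbb{F}_2\mathbb{Z}_3$); $E$: $x^2=y,\ y^2=xy=yx=0$; $F$: $x^2=y,\ xy=yx=1+y,\ y^2=1+x+y$ (the field $\mathbb{F}_8$); $G$: $x^2=x,\ y^2=0,\ xy=y,\ yx=0$. Every $3$-dimensional bialgebra over $\mathbb{F}_2$ has algebra isomorphic to $B$, $C$, $D$ or $G$ (so $A$, $E$, $F$ admit no bialgebra structure), and the number of isomorphism classes of bialgebras of type $(X,Y^* )$ is as follows: - type $(B,B^* )$: $1$; $(B,C^* )$: $3$; $(B,D^* )$: $1$; $(B,G^* )$: $2$; - type $(C,B^* )$: $3$; $(C,C^* )$: $3$; $(C,G^* )$: $2$; - type $(D,B^* )$: $1$; $(D,G^* )$: $2$; - type $(G,B^* )$: $2$; $(G,C^* )$: $2$; $(G,D^* )$: $2$; - all other types: $0$. Among these the only Hopf algebras are the unique one of type $(B,D^* )$, namely the function Hopf algebra $\mathbb{F}_2(\mathbb{Z}_3)$, and the unique one of type $(D,B^* )$, namely the group Hopf algebra $\mathbb{F}_2\mathbb{Z}_3$.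
   Context: Algebras are unital associative and coalgebras counital coassociative; in a bialgebra $\Delta$ and $\epsilon$ are unital algebra homomorphisms; a Hopf algebra is a bialgebra admitting an antipode. Isomorphisms of bialgebras are linear bijections that are both algebra and coalgebra maps. A finite-dimensional bialgebra $H$ is of type $(X,Y^* )$, for algebras $X,Y$, if $H\cong X$ as an algebra and the dual algebra $H^*$ (with product dual to the coproduct, $\langle fg,h\rangle=\langle f\otimes g,\Delta h\rangle$) is isomorphic to $Y$, equivalently $H$ is isomorphic as a coalgebra to the dual coalgebra of $Y$. *)

(* Defs.v *)
From HB Require Import structures.
From mathcomp Require Import all_boot all_fingroup all_algebra falgebra.

Set Implicit Arguments.
Unset Strict Implicit.
Unset Printing Implicit Defensive.

Import GRing.Theory.
Local Open Scope ring_scope.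

Reserved Notation "u \ox v" (at level 40, left associativity).

(* The tensor product of two finite-dimensional spaces is represented by      *)
(* coordinate matrices in the library's chosen bases: t : tensor U V stands   *)
(* for \sum_(i, j) t i j *: (e_i \ox e_j).  Lemmas tlift_tens and             *)
(* tlift_unique below give its universal property.                            *)

Definition tensor (F : fieldType) (U V : vectType F) :=
  'M[F]_(\dim {:U}, \dim {:V}).

HB.instance Definition _ (F : fieldType) (U V : vectType F) :=
  Vector.on (tensor U V).

Definition tens (F : fieldType) (U V : vectType F) (u : U) (v : V) :
    tensor U V :=
  \matrix_(i, j) (coord (vbasis {:U}) i u * coord (vbasis {:V}) j v).

Notation "u \ox v" := (tens u v) : ring_scope.

(* The linear map on U \ox V induced by a bilinear f : U -> V -> W. *)
Definition tlift (F : fieldType) (U V : vectType F) (W : lmodType F)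
    (f : U -> V -> W) (t : tensor U V) : W :=
  \sum_i \sum_j t i j *: f (vbasis {:U})`_i (vbasis {:V})`_j.

Definition bilin (F : fieldType) (U V W : lmodType F) (f : U -> V -> W) :=
  (forall v, linear (f^~ v)) /\ (forall u, linear (f u)).

Section Tensor.

Variables (F : fieldType).
Implicit Types (U V W : vectType F) (X Y : lmodType F).

Lemma linear_sumE X Y (f : X -> Y) (lf : linear f) (I : Type) (r : seq I)
    (P : pred I) (c : I -> F) (e : I -> X) :
  f (\sum_(i <- r | P i) c i *: e i) = \sum_(i <- r | P i) c i *: f (e i).
Proof.
have f0 : f 0 = 0 by have := lf (-1) 0 0; rewrite scaler0 addr0 scaleN1r addNr.
elim: r => [|i r IH]; first by rewrite !big_nil.
by rewrite !big_cons; case: (P i); rewrite // lf IH.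
Qed.

Lemma tlift_tens U V X (f : U -> V -> X) u v :
  bilin f -> tlift f (u \ox v) = f u v.
Proof.
move=> [fl fr]; rewrite /tlift.
rewrite [in RHS](coord_vbasis (memvf u)) (linear_sumE (fl v)).
apply: eq_bigr => i _.
rewrite [in RHS](coord_vbasis (memvf v)) (linear_sumE (fr _)) scaler_sumr.
by apply: eq_bigr => j _; rewrite mxE scalerA.
Qed.

Lemma tlift_linear U V X (f : U -> V -> X) : linear (tlift f).
Proof.
move=> a s t; rewrite /tlift scaler_sumr -big_split; apply: eq_bigr => i _ /=.
rewrite scaler_sumr -big_split; apply: eq_bigr => j _ /=.
by rewrite !mxE scalerDl scalerA.
Qed.

HB.instance Definition _ U V X (f : U -> V -> X) :=
  GRing.isLinear.Build F (tensor U V) X _ (tlift f) (tlift_linear f).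

Lemma eq_tlift U V X (f g : U -> V -> X) : f =2 g -> tlift f =1 tlift g.
Proof.
move=> fg t; apply: eq_bigr => i _; apply: eq_bigr => j _.
by rewrite fg.
Qed.

Lemma linear_tlift U V X Y (L : {linear X -> Y}) (f : U -> V -> X) t :
  L (tlift f t) = tlift (fun u v => L (f u v)) t.
Proof.
rewrite linear_sum; apply: eq_bigr => i _; rewrite linear_sum.
by apply: eq_bigr => j _; rewrite linearZ.
Qed.

Lemma coord_vbasisE U i j :
  coord (vbasis {:U}) i (vbasis {:U})`_(j : 'I__) = (i == j)%:R.
Proof.
by rewrite coord_free ?(basis_free (vbasisP _)) // eq_sym.
Qed.

Lemma tlift_idE U V (t : tensor U V) : tlift (@tens F U V) t = t.
Proof.
apply/matrixP => i j; rewrite summxE (bigD1 i) //= [X in _ + X]big1.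
  rewrite addr0 summxE (bigD1 j) //= [X in _ + X]big1.
    by rewrite !mxE !coord_vbasisE !eqxx !mulr1 addr0.
  move=> k /negPf kj; rewrite !mxE !coord_vbasisE [j == k]eq_sym kj.
  by rewrite !mulr0.
move=> k /negPf ki; rewrite summxE big1 // => l _.
by rewrite !mxE !coord_vbasisE [i == k]eq_sym ki mul0r mulr0.
Qed.

Lemma tlift_unique U V X (L : {linear tensor U V -> X}) t :
  L t = tlift (fun u v => L (u \ox v)) t.
Proof. by rewrite -[in LHS](tlift_idE t) linear_tlift. Qed.

Lemma tens_bilin U V : bilin (@tens F U V).
Proof.
split=> [v|u] a x y; apply/matrixP=> i j; rewrite !mxE linearD linearZ /=.
  by rewrite mulrDl mulrA.
by rewrite mulrDr mulrCA.
Qed.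

End Tensor.

(* (f \ox g) and the canonical U \ox V \ox W -> U \ox (V \ox W). *)
Definition tmap (F : fieldType) (U V U' V' : vectType F)
    (f : U -> U') (g : V -> V') : tensor U V -> tensor U' V' :=
  tlift (fun u v => f u \ox g v).

Definition tassoc (F : fieldType) (U V W : vectType F) :
    tensor (tensor U V) W -> tensor U (tensor V W) :=
  tlift (fun t w => tlift (fun u v => u \ox (v \ox w)) t).

(* (a \ox b) (c \ox d) = (a * c) \ox (b * d) *)
Definition tmul (F : fieldType) (A B : falgType F) (s t : tensor A B) :
    tensor A B :=
  tlift (fun a b => tlift (fun c d => (a * c) \ox (b * d)) t) s.

HB.mixin Record Vector_isCoalgebra (F : fieldType) C of Vector F C := {
  coprod : {linear C -> tensor C C};
  counit : {linear C -> F^o};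
  coprodA : forall c : C,
    tassoc (tmap coprod idfun (coprod c)) = tmap idfun coprod (coprod c);
  counitl : forall c : C, tlift (fun a b => (counit a : F) *: b) (coprod c) = c;
  counitr : forall c : C, tlift (fun a b => (counit b : F) *: a) (coprod c) = c
}.

#[short(type="coalgType")]
HB.structure Definition Coalgebra (F : fieldType) :=
  { C of Vector F C & Vector_isCoalgebra F C }.

HB.mixin Record Falgebra_isBialgebra (F : fieldType) H
    of Falgebra F H & Coalgebra F H := {
  coprodM : forall a b : H, coprod (a * b) = tmul (coprod a) (coprod b);
  coprod1 : coprod (1 : H) = 1 \ox 1;
  counitM : forall a b : H, counit (a * b) = counit a * counit b;
  counit1 : counit (1 : H) = 1
}.

#[short(type="bialgType")]
HB.structure Definition Bialgebra (F : fieldType) :=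
  { H of Falgebra F H & Coalgebra F H & Falgebra_isBialgebra F H }.

Section TensorMaps.

Variables (F : fieldType).

Lemma tlift_bilin_sum (U V : vectType F) (X : lmodType F) a
    (f g : U -> V -> X) t :
  tlift (fun u v => a *: f u v + g u v) t = a *: tlift f t + tlift g t.
Proof.
rewrite /tlift scaler_sumr -big_split; apply: eq_bigr => i _ /=.
rewrite scaler_sumr -big_split; apply: eq_bigr => j _ /=.
by rewrite scalerDr !scalerA mulrC.
Qed.

HB.instance Definition _ (U V U' V' : vectType F) (f : U -> U')
    (g : V -> V') :=
  GRing.isLinear.Build F (tensor U V) (tensor U' V') _ (tmap f g)
    (tlift_linear _).

HB.instance Definition _ (U V W : vectType F) :=
  GRing.isLinear.Build F (tensor (tensor U V) W) (tensor U (tensor V W)) _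
    (@tassoc F U V W) (tlift_linear _).

Lemma tmap_tens (U V U' V' : vectType F) (f : {linear U -> U'})
    (g : {linear V -> V'}) u v : tmap f g (u \ox v) = f u \ox g v.
Proof.
have [l r] := @tens_bilin F U' V'.
apply: tlift_tens; split=> [x|x] a y z; rewrite linearP; [exact: l|exact: r].
Qed.

Lemma tassoc_tens (U V W : vectType F) (u : U) (v : V) (w : W) :
  tassoc (u \ox v \ox w) = u \ox (v \ox w).
Proof.
have [lU rU] := @tens_bilin F U (tensor V W).
have [lV rV] := @tens_bilin F V W.
rewrite /tassoc tlift_tens; last first.
  split=> [x|x] a y z; first by rewrite linearP.
  rewrite -tlift_bilin_sum; apply: eq_tlift => u' v'.
  by rewrite rV rU.
rewrite tlift_tens //; split=> [x|x] a y z; first by rewrite lU.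
by rewrite lV rU.
Qed.

Lemma tmul_tens (A B : falgType F) (a c : A) (b d : B) :
  tmul (a \ox b) (c \ox d) = (a * c) \ox (b * d).
Proof.
have [l r] := @tens_bilin F A B.
rewrite /tmul tlift_tens; last first.
  split=> x k y z; rewrite -tlift_bilin_sum; apply: eq_tlift => p q.
    by rewrite mulrDl -scalerAl l.
  by rewrite mulrDl -scalerAl r.
rewrite tlift_tens //; split=> x k y z.
  by rewrite mulrDr -scalerAr l.
by rewrite mulrDr -scalerAr r.
Qed.

Lemma tlift_tmap (U V U' V' : vectType F) (X : lmodType F) (b : U' -> V' -> X)
    (f : U -> U') (g : V -> V') t : bilin b ->
  tlift b (tmap f g t) = tlift (fun u v => b (f u) (g v)) t.
Proof.
move=> bb; rewrite /tmap linear_tlift; apply: eq_tlift => u v.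
exact: tlift_tens.
Qed.

Lemma tlift_tassoc (U V W : vectType F) (X : lmodType F)
    (b : U -> tensor V W -> X) t : bilin b ->
  tlift b (tassoc t)
    = tlift (fun s w => tlift (fun u v => b u (v \ox w)) s) t.
Proof.
move=> bb; rewrite /tassoc linear_tlift; apply: eq_tlift => s w.
by rewrite linear_tlift; apply: eq_tlift => u v; apply: tlift_tens.
Qed.

Lemma eq_linear_tens (U V : vectType F) (X : lmodType F)
    (f g : {linear tensor U V -> X}) :
  (forall u v, f (u \ox v) = g (u \ox v)) -> f =1 g.
Proof.
by move=> fg t; rewrite tlift_unique [RHS]tlift_unique; apply: eq_tlift.
Qed.

Lemma tmul_bilin (A B : falgType F) : bilin (@tmul F A B).
Proof.
split=> [t a s s'|s a t t']; first exact: tlift_linear.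
by rewrite /tmul -tlift_bilin_sum; apply: eq_tlift => x y; rewrite linearP.
Qed.

Lemma bilin_mul (U V : vectType F) (f : {linear U -> F^o})
    (g : {linear V -> F^o}) : bilin (fun a b => f a * g b : F^o).
Proof.
split=> x a y z; rewrite linearP; first by rewrite mulrDl -scalerAl.
by rewrite mulrDr -scalerAr.
Qed.

End TensorMaps.

(* The dual algebra H^* : <f g, h> = <f \ox g, coprod h>, with unit counit.   *)
Definition dual_alg (F : fieldType) (H : bialgType F) := 'Hom(H, F^o).

Section DualAlgebra.

Variables (F : fieldType) (H : bialgType F).

HB.instance Definition _ := Vector.on (dual_alg H).

Implicit Types f g k : dual_alg H.

Definition dual_one : dual_alg H := linfun (@counit F H).

Definition dual_mul f g : dual_alg H :=
  linfun (tlift (fun a b => f a * g b : F^o) \o @coprod F H).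

Let dual_mulE f g h :
  dual_mul f g h = tlift (fun a b => f a * g b : F^o) (coprod h).
Proof. by rewrite lfunE. Qed.

Lemma dual_mulA : associative dual_mul.
Proof.
move=> f g k; apply/lfunP => h; rewrite !dual_mulE.
pose fg (a b : H) : F^o := f a * g b.
pose gk (a b : H) : F^o := g a * k b.
transitivity (tlift (fun a t => f a * tlift gk t : F^o)
                (tmap idfun (@coprod F H) (coprod h))).
  rewrite tlift_tmap; last exact: bilin_mul.
  by apply: eq_tlift => a b /=; rewrite dual_mulE.
rewrite -coprodA tlift_tassoc; last exact: bilin_mul.
transitivity (tlift (fun t c => tlift fg t * k c : F^o)
                (tmap (@coprod F H) idfun (coprod h))); last first.
  rewrite tlift_tmap; last exact: bilin_mul.
  by apply: eq_tlift => a b /=; rewrite dual_mulE.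
apply: eq_tlift => s c.
have -> : tlift fg s * k c = tlift (fun u v => fg u v * k c : F^o) s.
  rewrite /tlift mulr_suml; apply: eq_bigr => i _.
  by rewrite mulr_suml; apply: eq_bigr => j _; rewrite -scalerAl.
apply: eq_tlift => a b; rewrite tlift_tens; last exact: bilin_mul.
by rewrite /fg /gk mulrA.
Qed.

Lemma dual_mul1l : left_id dual_one dual_mul.
Proof.
move=> f; apply/lfunP => h; rewrite dual_mulE -[in RHS](counitl h) linear_tlift.
by apply: eq_tlift => a b; rewrite lfunE linearZ.
Qed.

Lemma dual_mul1r : right_id dual_one dual_mul.
Proof.
move=> f; apply/lfunP => h; rewrite dual_mulE -[in RHS](counitr h) linear_tlift.
by apply: eq_tlift => a b; rewrite lfunE linearZ mulrC.
Qed.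

Lemma dual_mul_linl k a f g :
  dual_mul (a *: f + g) k = a *: dual_mul f k + dual_mul g k.
Proof.
apply/lfunP => h; rewrite !lfunE /= !lfunE /= !lfunE /= -tlift_bilin_sum.
by apply: eq_tlift => x y; rewrite !lfunE /= !lfunE /= mulrDl scalerAl.
Qed.

Lemma dual_mul_linr k a f g :
  dual_mul k (a *: f + g) = a *: dual_mul k f + dual_mul k g.
Proof.
apply/lfunP => h; rewrite !lfunE /= !lfunE /= !lfunE /= -tlift_bilin_sum.
by apply: eq_tlift => x y; rewrite !lfunE /= !lfunE /= mulrDr scalerAr.
Qed.

Lemma dual_mulDl : left_distributive dual_mul +%R.
Proof. by move=> f g k; rewrite -[f]scale1r dual_mul_linl !scale1r. Qed.

Lemma dual_mulDr : right_distributive dual_mul +%R.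
Proof. by move=> k f g; rewrite -[f]scale1r dual_mul_linr !scale1r. Qed.

Lemma dual_one_neq0 : dual_one != 0.
Proof.
apply/eqP => /lfunP/(_ 1)/eqP; rewrite !lfunE /= counit1.
by rewrite (oner_eq0 F).
Qed.

HB.instance Definition _ := GRing.Zmodule_isNzRing.Build (dual_alg H)
  dual_mulA dual_mul1l dual_mul1r dual_mulDl dual_mulDr dual_one_neq0.

Lemma dual_scaleAl a f g : a *: (f * g) = (a *: f) * g.
Proof.
rewrite -[in RHS](addr0 (a *: f)) -[RHS]/(dual_mul _ _) dual_mul_linl.
by rewrite -[dual_mul 0 g]/(0 * g) mul0r addr0.
Qed.

HB.instance Definition _ :=
  GRing.Lmodule_isLalgebra.Build F (dual_alg H) dual_scaleAl.

Lemma dual_scaleAr a f g : a *: (f * g) = f * (a *: g).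
Proof.
rewrite -[in RHS](addr0 (a *: g)) -[RHS]/(dual_mul _ _) dual_mul_linr.
by rewrite -[dual_mul f 0]/(f * 0) mulr0 addr0.
Qed.

HB.instance Definition _ :=
  GRing.Lalgebra_isAlgebra.Build F (dual_alg H) dual_scaleAr.

HB.instance Definition _ := Algebra_isFalgebra.Build F (dual_alg H).

End DualAlgebra.

Definition alg_iso (F : fieldType) (X Y : falgType F) :=
  exists f : {lrmorphism X -> Y}, bijective f.

Definition bialg_iso (F : fieldType) (H K : bialgType F) :=
  exists f : {lrmorphism H -> K},
    [/\ bijective f, forall h, coprod (f h) = tmap f f (coprod h)
      & forall h, counit (f h) = counit h].

Definition is_hopf (F : fieldType) (H : bialgType F) :=
  exists S : {linear H -> H},
    (forall h, tlift (fun a b => S a * b) (coprod h) = (counit h : F) *: (1 : H)) /\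
    (forall h, tlift (fun a b => a * S b) (coprod h) = (counit h : F) *: (1 : H)).

Definition of_type (F : fieldType) (X Y : falgType F) (H : bialgType F) :=
  alg_iso H X /\ alg_iso (dual_alg H) Y.

(* The bialgebras satisfying P form exactly n isomorphism classes. *)
Definition num_iso_classes (F : fieldType) (P : bialgType F -> Prop) n :=
  exists s : 'I_n -> bialgType F,
    [/\ forall i, P (s i),
        forall i j, bialg_iso (s i) (s j) -> i = j
      & forall H, P H -> exists i, bialg_iso H (s i)].

(* The algebras A, ..., G over F_2, on row vectors of coordinates in the      *)
(* basis 1, x, y.  The table lists the products x^2, xy, yx, y^2.             *)

Variant alg_name := nA | nB | nC | nD | nE | nF | nG.

Definition vec3 (a b c : 'F_2) : 'rV['F_2]_3 := \row_j [:: a; b; c]`_j.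

Definition alg_table (n : alg_name) : seq (seq 'rV['F_2]_3) :=
  let o := vec3 1 0 0 in let x := vec3 0 1 0 in let y := vec3 0 0 1 in
  let table xx xy yx yy :=
    [:: [:: o; x; y]; [:: x; xx; xy]; [:: y; yx; yy]] in
  match n with
  | nA => table 0 0 0 0
  | nB => table x 0 0 y
  | nC => table x 0 0 0
  | nD => table y (x + y) (x + y) x
  | nE => table y 0 0 0
  | nF => table y (o + y) (o + y) (o + x + y)
  | nG => table x y 0 0
  end.

Definition alg3 (n : alg_name) := 'rV['F_2]_3.

(* The coordinates of the entries of alg_table, in computable form. *)
Definition alg_coef (n : alg_name) (i j q : nat) : 'F_2 :=
  let table xx xy yx yy :=
    [:: [:: [:: 1; 0; 0]; [:: 0; 1; 0]; [:: 0; 0; 1]];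
        [:: [:: 0; 1; 0]; xx; xy]; [:: [:: 0; 0; 1]; yx; yy]] in
  let z := [:: 0; 0; 0] in let x := [:: 0; 1; 0] in let y := [:: 0; 0; 1] in
  nth 0 (nth [::] (nth [::] match n with
  | nA => table z z z z
  | nB => table x z z y
  | nC => table x z z z
  | nD => table y [:: 0; 1; 1] [:: 0; 1; 1] x
  | nE => table y z z z
  | nF => table y [:: 1; 0; 1] [:: 1; 0; 1] [:: 1; 1; 1]
  | nG => table x y z z
  end i) j) q.

Lemma alg_tableE n (i j q : 'I_3) :
  (nth 0 (nth [::] (alg_table n) i) j) 0 q = alg_coef n i j q.
Proof.
case: i j q => [[|[|[|//]]] ?] [[|[|[|//]]] ?] [q lq]; case: n => /=;
  rewrite ?mxE //=; case: q lq => [|[|[|//]]] ? //=; exact: val_inj.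
Qed.

Lemma alg_coef_assoc n :
  let c := alg_coef n in let s := iota 0 3 in
  all (fun i => all (fun j => all (fun k => all (fun q =>
    c j k 0 * c i 0 q + (c j k 1 * c i 1 q + c j k 2 * c i 2 q) ==
    c i j 0 * c 0 k q + (c i j 1 * c 1 k q + c i j 2 * c 2 k q)) s) s) s) s.
Proof. by case: n; vm_compute. Qed.

Section Alg3.

Variable n : alg_name.

HB.instance Definition _ := Vector.on (alg3 n).

Definition alg3_one : alg3 n := vec3 1 0 0.

Definition alg3_mul (u v : alg3 n) : alg3 n :=
  \sum_(i < 3) \sum_(j < 3) (u 0 i * v 0 j) *: nth 0 (nth [::] (alg_table n) i) j.

Let tab (i j : 'I_3) : 'rV['F_2]_3 := nth 0 (nth [::] (alg_table n) i) j.
Let e (i : 'I_3) : alg3 n := delta_mx 0 i.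

Lemma alg3_mul_bilin : bilin alg3_mul.
Proof.
split=> w a u v; rewrite /alg3_mul scaler_sumr -big_split; apply: eq_bigr => i _;
  rewrite scaler_sumr -big_split; apply: eq_bigr => j _; rewrite !mxE /=.
  by rewrite mulrDl scalerDl scalerA mulrA.
by rewrite mulrDr scalerDl scalerA mulrCA.
Qed.

Lemma alg3_mulE i j : alg3_mul (e i) (e j) = tab i j.
Proof.
rewrite /alg3_mul (bigD1 i) //= [X in _ + X]big1.
  rewrite addr0 (bigD1 j) //= [X in _ + X]big1 => [|k /negPf kj].
    by rewrite !mxE !eqxx mulr1 scale1r addr0.
  by rewrite !mxE kj mulr0 scale0r.
by move=> k /negPf ki; rewrite big1 // => l _; rewrite !mxE ki mul0r scale0r.
Qed.

Lemma alg3_mul1l : left_id alg3_one alg3_mul.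
Proof.
move=> u; rewrite /alg3_mul !big_ord_recl !big_ord0.
apply/rowP=> q; rewrite !mxE /= !(mul1r, mul0r, addr0, add0r).
by case: n q; case=> [[|[|[|//]]] ?]; rewrite /= !mxE /=
  !(mulr1, mulr0, addr0, add0r); congr (u _ _); apply: val_inj.
Qed.

Lemma alg3_mul1r : right_id alg3_one alg3_mul.
Proof.
move=> u; rewrite /alg3_mul !big_ord_recl !big_ord0.
apply/rowP=> q; rewrite !mxE /= !(mulr1, mulr0, mul0r, addr0, add0r).
by case: n q; case=> [[|[|[|//]]] ?]; rewrite /= !mxE /=
  !(mulr1, mulr0, mul0r, addr0, add0r); congr (u _ _); apply: val_inj.
Qed.

Lemma alg3_mulA : associative alg3_mul.
Proof.
have [l r] := alg3_mul_bilin.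
have assoc_e i j k :
    alg3_mul (e i) (alg3_mul (e j) (e k)) = alg3_mul (alg3_mul (e i) (e j)) (e k).
  rewrite !alg3_mulE [tab j k]row_sum_delta [tab i j]row_sum_delta.
  rewrite (linear_sumE (r _)) (linear_sumE (l _)).
  under eq_bigr do rewrite alg3_mulE.
  under [RHS]eq_bigr do rewrite alg3_mulE.
  rewrite !big_ord_recl !big_ord0 /tab.
  apply/rowP=> q; rewrite !mxE !alg_tableE /= !addr0; apply/eqP.
  have m (p : 'I_3) : (p : nat) \in iota 0 3 by rewrite mem_iota ltn_ord.
  by have /allP/(_ _ (m i))/allP/(_ _ (m j))/allP/(_ _ (m k))/allP/(_ _ (m q))
    := alg_coef_assoc n.
move=> u v w.
rewrite [u]row_sum_delta (linear_sumE (l _)).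
have -> : alg3_mul (\sum_i u 0 i *: delta_mx 0 i) v
        = \sum_i u 0 i *: alg3_mul (e i) v by rewrite (linear_sumE (l _)).
rewrite (linear_sumE (l _)); apply: eq_bigr => i _; congr (_ *: _).
rewrite [v]row_sum_delta (linear_sumE (l _)) !(linear_sumE (r _)).
rewrite (linear_sumE (l _)); apply: eq_bigr => j _; congr (_ *: _).
rewrite [w]row_sum_delta !(linear_sumE (r _)).
by apply: eq_bigr => k _; rewrite assoc_e.
Qed.

Lemma alg3_mulDl : left_distributive alg3_mul +%R.
Proof.
move=> u v w; have := alg3_mul_bilin.1 w 1 u v.
by rewrite !scale1r.
Qed.

Lemma alg3_mulDr : right_distributive alg3_mul +%R.
Proof.
move=> u v w; have := alg3_mul_bilin.2 u 1 v w.
by rewrite !scale1r.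
Qed.

Lemma alg3_one_neq0 : alg3_one != 0.
Proof. by apply/eqP => /rowP/(_ 0)/eqP; rewrite !mxE. Qed.

HB.instance Definition _ := GRing.Zmodule_isNzRing.Build (alg3 n)
  alg3_mulA alg3_mul1l alg3_mul1r alg3_mulDl alg3_mulDr alg3_one_neq0.

Lemma alg3_scaleAl (a : 'F_2) (u v : alg3 n) : a *: (u * v) = (a *: u) * v.
Proof.
have [l _] := alg3_mul_bilin.
rewrite -[in RHS](addr0 (a *: u)) -[RHS]/(alg3_mul _ _) l.
by rewrite -[alg3_mul 0 v]/(0 * v) mul0r addr0.
Qed.

HB.instance Definition _ :=
  GRing.Lmodule_isLalgebra.Build 'F_2 (alg3 n) alg3_scaleAl.

Lemma alg3_scaleAr (a : 'F_2) (u v : alg3 n) : a *: (u * v) = u * (a *: v).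
Proof.
have [_ r] := alg3_mul_bilin.
rewrite -[in RHS](addr0 (a *: v)) -[RHS]/(alg3_mul _ _) r.
by rewrite -[alg3_mul u 0]/(u * 0) mulr0 addr0.
Qed.

HB.instance Definition _ :=
  GRing.Lalgebra_isAlgebra.Build 'F_2 (alg3 n) alg3_scaleAr.

HB.instance Definition _ := Algebra_isFalgebra.Build 'F_2 (alg3 n).

End Alg3.

(* The number of isomorphism classes of bialgebras of type (X, Y^* ).         *)
Definition bialg_count (X Y : alg_name) : nat :=
  match X, Y with
  | nB, nB => 1 | nB, nC => 3 | nB, nD => 1 | nB, nG => 2
  | nC, nB => 3 | nC, nC => 3 | nC, nG => 2
  | nD, nB => 1 | nD, nG => 2
  | nG, nB => 2 | nG, nC => 2 | nG, nD => 2
  | _, _ => 0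
  end.

(* For a finite group, the Hopf algebra of functions, with coproduct          *)
(* (coprod f) (g, h) = f (g h), and the group Hopf algebra, with grouplike    *)
(* basis \delta_g.                                                            *)

Definition fun_alg (F : fieldType) (gT : finGroupType) := {ffun gT -> F^o}.

Section FunctionAlgebra.

Variables (F : fieldType) (gT : finGroupType).

HB.instance Definition _ := Vector.on (fun_alg F gT).

Implicit Types f k : fun_alg F gT.

Definition fun_one : fun_alg F gT := [ffun => 1].
Definition fun_mul f k : fun_alg F gT := [ffun g => f g * k g].

Lemma fun_mulA : associative fun_mul.
Proof. by move=> f k l; apply/ffunP => g; rewrite !ffunE mulrA. Qed.

Lemma fun_mul1l : left_id fun_one fun_mul.
Proof. by move=> f; apply/ffunP => g; rewrite !ffunE mul1r. Qed.

Lemma fun_mul1r : right_id fun_one fun_mul.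
Proof. by move=> f; apply/ffunP => g; rewrite !ffunE mulr1. Qed.

Lemma fun_mulDl : left_distributive fun_mul +%R.
Proof. by move=> f k l; apply/ffunP => g; rewrite !ffunE mulrDl. Qed.

Lemma fun_mulDr : right_distributive fun_mul +%R.
Proof. by move=> f k l; apply/ffunP => g; rewrite !ffunE mulrDr. Qed.

Lemma fun_one_neq0 : fun_one != 0.
Proof.
by apply/eqP => /ffunP/(_ 1%g)/eqP; rewrite !ffunE (oner_eq0 F).
Qed.

HB.instance Definition _ := GRing.Zmodule_isNzRing.Build (fun_alg F gT)
  fun_mulA fun_mul1l fun_mul1r fun_mulDl fun_mulDr fun_one_neq0.

Lemma fun_scaleAl (a : F) f k : a *: (f * k) = (a *: f) * k.
Proof. by apply/ffunP => g; rewrite !ffunE scalerAl. Qed.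

HB.instance Definition _ :=
  GRing.Lmodule_isLalgebra.Build F (fun_alg F gT) fun_scaleAl.

Lemma fun_scaleAr (a : F) f k : a *: (f * k) = f * (a *: k).
Proof. by apply/ffunP => g; rewrite !ffunE scalerAr. Qed.

HB.instance Definition _ :=
  GRing.Lalgebra_isAlgebra.Build F (fun_alg F gT) fun_scaleAr.

HB.instance Definition _ := Algebra_isFalgebra.Build F (fun_alg F gT).

Let linear_sum2E (X Y : lmodType F) (p : X -> Y) (lp : linear p)
    (c : gT -> gT -> F) (e : gT -> gT -> X) :
  p (\sum_g \sum_h c g h *: e g h) = \sum_g \sum_h c g h *: p (e g h).
Proof. by rewrite !pair_bigA (linear_sumE lp). Qed.

Definition fun_delta (g : gT) : fun_alg F gT := [ffun x => (x == g)%:R].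

Definition fun_coprod f : tensor (fun_alg F gT) (fun_alg F gT) :=
  \sum_g \sum_h (f (g * h)%g : F) *: (fun_delta g \ox fun_delta h).

Definition fun_counit f : F^o := f 1%g.

Lemma fun_coprod_linear : linear fun_coprod.
Proof.
move=> a f k; rewrite /fun_coprod scaler_sumr -big_split.
apply: eq_bigr => g _ /=; rewrite scaler_sumr -big_split.
by apply: eq_bigr => h _ /=; rewrite !ffunE scalerDl scalerA.
Qed.

HB.instance Definition _ :=
  GRing.isLinear.Build F _ _ _ fun_coprod fun_coprod_linear.

Lemma fun_counit_linear : linear fun_counit.
Proof. by move=> a f k; rewrite /fun_counit !ffunE. Qed.

HB.instance Definition _ :=
  GRing.isLinear.Build F _ _ _ fun_counit fun_counit_linear.

Lemma fun_sum_delta f : f = \sum_g (f g : F) *: fun_delta g.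
Proof.
apply/ffunP => x; rewrite sum_ffunE (bigD1 x) //= big1 => [|g /negPf gx].
  by rewrite !ffunE eqxx addr0 [_ *: _]mulr1.
by rewrite !ffunE eq_sym gx scaler0.
Qed.

Let ev (x y : gT) : tensor (fun_alg F gT) (fun_alg F gT) -> F^o :=
  tlift (fun a b : fun_alg F gT => a x * b y : F^o).

Let ev_linear x y : linear (ev x y).
Proof. exact: tlift_linear. Qed.

Let ev_tens x y f k : ev x y (f \ox k) = f x * k y.
Proof.
apply: tlift_tens; split=> u a f' k'; rewrite !ffunE.
  by rewrite mulrDl scalerAl.
by rewrite mulrDr scalerAr.
Qed.

Let sum_ev t :
  t = \sum_x \sum_y (ev x y t : F) *: (fun_delta x \ox fun_delta y).
Proof.
pose L t := \sum_x \sum_y (ev x y t : F) *: (fun_delta x \ox fun_delta y).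
have LL : linear L.
  move=> a s s'; rewrite /L scaler_sumr -big_split.
  apply: eq_bigr => g _ /=; rewrite scaler_sumr -big_split.
  by apply: eq_bigr => h _ /=; rewrite ev_linear scalerDl scalerA.
pose Llin : {linear tensor (fun_alg F gT) (fun_alg F gT) -> _} :=
  HB.pack L (GRing.isLinear.Build F _ _ _ L LL).
apply: (eq_linear_tens (f := idfun) (g := Llin)) => f k /=.
have [l r] := @tens_bilin F (fun_alg F gT) (fun_alg F gT).
rewrite /L {1}(fun_sum_delta f) (linear_sumE (l _)); apply: eq_bigr => x _.
rewrite {1}(fun_sum_delta k) (linear_sumE (r _)) scaler_sumr.
by apply: eq_bigr => y _; rewrite ev_tens scalerA.
Qed.

Let ev_ext s t : (forall x y, ev x y s = ev x y t) -> s = t.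
Proof.
move=> st; rewrite (sum_ev s) (sum_ev t); apply: eq_bigr => x _.
by apply: eq_bigr => y _; rewrite st.
Qed.

Let ev_tmul x y s t : ev x y (tmul s t) = ev x y s * ev x y t.
Proof.
pose evL : {linear tensor (fun_alg F gT) (fun_alg F gT) -> F^o} :=
  HB.pack (ev x y) (GRing.isLinear.Build F _ _ _ (ev x y) (ev_linear x y)).
have [l r] := @tmul_bilin F (fun_alg F gT) (fun_alg F gT).
rewrite [LHS](linear_tlift evL) /ev {3}/tlift mulr_suml.
apply: eq_bigr => i _; rewrite mulr_suml; apply: eq_bigr => j _.
rewrite -scalerAl; congr (_ *: _); rewrite /= [LHS](linear_tlift evL).
rewrite {2}/tlift mulr_sumr; apply: eq_bigr => i' _.
rewrite mulr_sumr; apply: eq_bigr => j' _; rewrite -scalerAr; congr (_ *: _).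
by rewrite /= ev_tens !ffunE mulrACA.
Qed.

Let ev_coprod x y f : ev x y (fun_coprod f) = f (x * y)%g.
Proof.
rewrite [LHS](linear_sum2E (ev_linear x y)).
under eq_bigr do under eq_bigr do rewrite ev_tens.
rewrite (bigD1 x) //= [X in _ + X]big1 => [|g /negPf gx]; last first.
  by rewrite big1 // => h _; rewrite !ffunE eq_sym gx mul0r scaler0.
rewrite addr0 (bigD1 y) //= [X in _ + X]big1 => [|h /negPf hy]; last first.
  by rewrite !ffunE [y == h]eq_sym hy mulr0 scaler0.
by rewrite !ffunE !eqxx mulr1 addr0 [LHS]mulr1.
Qed.

Lemma fun_coprod_delta g :
  fun_coprod (fun_delta g)
    = \sum_h fun_delta h \ox fun_delta (h^-1 * g)%g.
Proof.
apply: eq_bigr => h _; rewrite (bigD1 (h^-1 * g)%g) //= big1 => [|k kg].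
  by rewrite !ffunE mulKVg eqxx scale1r addr0.
rewrite !ffunE (_ : (h * k == g)%g = false) ?scale0r //.
by apply: contraNF kg => /eqP <-; rewrite mulKg.
Qed.

Lemma fun_coprodA f :
  tassoc (tmap fun_coprod idfun (fun_coprod f))
    = tmap idfun fun_coprod (fun_coprod f).
Proof.
have [l r] := @tens_bilin F (fun_alg F gT) (tensor (fun_alg F gT) (fun_alg F gT)).
have [l' r'] := @tens_bilin F (tensor (fun_alg F gT) (fun_alg F gT)) (fun_alg F gT).
have lL : linear (fun t : tensor (fun_alg F gT) (fun_alg F gT) =>
    tassoc (tmap fun_coprod (@idfun (fun_alg F gT)) t)).
  by move=> a s t; rewrite /tassoc /tmap !tlift_linear.
have lR : linear (tmap (@idfun (fun_alg F gT)) fun_coprod) := tlift_linear _.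
rewrite {2 4}/fun_coprod (linear_sum2E lL) (linear_sum2E lR).
transitivity (\sum_a \sum_b \sum_h (f (a * b * h)%g : F) *:
    (fun_delta a \ox (fun_delta b \ox fun_delta h))).
  transitivity (\sum_g \sum_h \sum_a (f (g * h)%g : F) *:
    (fun_delta a \ox (fun_delta (a^-1 * g)%g \ox fun_delta h))).
    apply: eq_bigr => g _; apply: eq_bigr => h _.
    rewrite tmap_tens /= fun_coprod_delta -scaler_sumr; congr (_ *: _).
    under eq_bigr do rewrite -[fun_delta _ \ox _]scale1r.
    rewrite (linear_sumE (l' _)) /tassoc (linear_sumE (@tlift_linear F _ _ _ _)).
    by apply: eq_bigr => a _; rewrite [tlift _ _]tassoc_tens scale1r.
  under eq_bigr do rewrite exchange_big /=.
  rewrite exchange_big /=; apply: eq_bigr => a _.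
  rewrite (reindex (mulg a)) /=; last first.
    by exists (mulg a^-1%g) => g _; rewrite ?mulKg ?mulKVg.
  by apply: eq_bigr => b _; apply: eq_bigr => h _; rewrite mulKg.
apply: eq_bigr => a _.
transitivity (\sum_g \sum_b (f (a * g)%g : F) *:
    (fun_delta a \ox (fun_delta b \ox fun_delta (b^-1 * g)%g))).
  rewrite [RHS]exchange_big /=; apply: eq_bigr => b _.
  rewrite [RHS](reindex (mulg b)) /=; last first.
    by exists (mulg b^-1%g) => g _; rewrite ?mulKg ?mulKVg.
  by apply: eq_bigr => h _; rewrite mulKg mulgA.
apply: eq_bigr => g _.
rewrite tmap_tens /= fun_coprod_delta -scaler_sumr; congr (_ *: _).
under [X in _ \ox X]eq_bigr do rewrite -[fun_delta _ \ox _]scale1r.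
by rewrite (linear_sumE (r _)); apply: eq_bigr => b _; rewrite scale1r.
Qed.

Lemma fun_counitl f :
  tlift (fun a b => (fun_counit a : F) *: b) (fun_coprod f) = f.
Proof.
rewrite (linear_sum2E (@tlift_linear F _ _ _ _)) [RHS]fun_sum_delta.
rewrite (bigD1 1%g) //= [X in _ + X]big1 => [|g /negPf g1]; last first.
  rewrite big1 // => h _; rewrite tlift_tens; last first.
    by split=> u a x y; rewrite !linearP ?scalerDl ?scalerDr ?scalerA // mulrC.
  by rewrite /fun_counit !ffunE eq_sym g1 scale0r scaler0.
rewrite addr0; apply: eq_bigr => h _; rewrite tlift_tens; last first.
  by split=> u a x y; rewrite !linearP ?scalerDl ?scalerDr ?scalerA // mulrC.
by rewrite /fun_counit !ffunE eqxx scale1r mul1g.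
Qed.

Lemma fun_counitr f :
  tlift (fun a b => (fun_counit b : F) *: a) (fun_coprod f) = f.
Proof.
rewrite (linear_sum2E (@tlift_linear F _ _ _ _)) exchange_big /= [RHS]fun_sum_delta.
rewrite (bigD1 1%g) //= [X in _ + X]big1 => [|g /negPf g1]; last first.
  rewrite big1 // => h _; rewrite tlift_tens; last first.
    by split=> u a x y; rewrite !linearP ?scalerDl ?scalerDr ?scalerA // mulrC.
  by rewrite /fun_counit !ffunE eq_sym g1 scale0r scaler0.
rewrite addr0; apply: eq_bigr => h _; rewrite tlift_tens; last first.
  by split=> u a x y; rewrite !linearP ?scalerDl ?scalerDr ?scalerA // mulrC.
by rewrite /fun_counit !ffunE eqxx scale1r mulg1.
Qed.

HB.instance Definition _ := Vector_isCoalgebra.Build F (fun_alg F gT)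
  fun_coprodA fun_counitl fun_counitr.

Lemma fun_coprodM f k : coprod (f * k) = tmul (coprod f) (coprod k).
Proof.
by apply: ev_ext => x y; rewrite ev_tmul /coprod /= !ev_coprod !ffunE.
Qed.

Lemma fun_coprod1 : coprod (1 : fun_alg F gT) = 1 \ox 1.
Proof.
by apply: ev_ext => x y; rewrite /coprod /= ev_coprod ev_tens !ffunE mulr1.
Qed.

Lemma fun_counitM f k : counit (f * k) = counit f * counit k.
Proof. by rewrite /counit /= /fun_counit !ffunE. Qed.

Lemma fun_counit1 : counit (1 : fun_alg F gT) = 1.
Proof. by rewrite /counit /= /fun_counit !ffunE. Qed.

HB.instance Definition _ := Falgebra_isBialgebra.Build F (fun_alg F gT)
  fun_coprodM fun_coprod1 fun_counitM fun_counit1.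

End FunctionAlgebra.

Definition grp_alg (F : fieldType) (gT : finGroupType) := {ffun gT -> F^o}.

Section GroupAlgebra.

Variables (F : fieldType) (gT : finGroupType).

HB.instance Definition _ := Vector.on (grp_alg F gT).

Implicit Types f k : grp_alg F gT.

Definition grp_delta (g : gT) : grp_alg F gT := [ffun x => (x == g)%:R].

Definition grp_one : grp_alg F gT := grp_delta 1%g.

Definition grp_mul f k : grp_alg F gT :=
  [ffun z => \sum_g f g * k (g^-1 * z)%g].

Lemma grp_mul_bilin : bilin grp_mul.
Proof.
split=> u a f k; apply/ffunP => z; rewrite !ffunE scaler_sumr -big_split.
  by apply: eq_bigr => g _; rewrite !ffunE /= mulrDl scalerAl.
by apply: eq_bigr => g _; rewrite !ffunE /= mulrDr scalerAr.
Qed.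

Lemma grp_mul_delta g h : grp_mul (grp_delta g) (grp_delta h) = grp_delta (g * h)%g.
Proof.
apply/ffunP => z; rewrite ffunE (bigD1 g) //= big1 => [|x /negPf xg].
  by rewrite !ffunE eqxx mul1r addr0 -(inj_eq (mulgI g)) mulKVg.
by rewrite !ffunE xg mul0r.
Qed.

Lemma grp_sum_delta f : f = \sum_g (f g : F) *: grp_delta g.
Proof. exact: fun_sum_delta. Qed.

Let eq_delta (X : lmodType F) (p q : grp_alg F gT -> X) :
  linear p -> linear q -> (forall g, p (grp_delta g) = q (grp_delta g)) ->
  p =1 q.
Proof.
move=> lp lq pq f; rewrite (grp_sum_delta f) (linear_sumE lp) (linear_sumE lq).
by apply: eq_bigr => g _; rewrite pq.
Qed.

Lemma grp_mulA : associative grp_mul.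
Proof.
have [l r] := grp_mul_bilin; move=> f k m.
apply: (eq_delta (p := fun f => grp_mul f _)
          (q := fun f => grp_mul (grp_mul f k) m)) => [||g].
- by move=> a x y; rewrite l.
- by move=> a x y; rewrite !l.
apply: (eq_delta (p := fun k => grp_mul _ (grp_mul k m))
          (q := fun k => grp_mul (grp_mul _ k) m)) => [||h].
- by move=> a x y; rewrite l r.
- by move=> a x y; rewrite r l.
apply: (eq_delta (p := fun m => grp_mul _ (grp_mul _ m))
          (q := fun m => grp_mul (grp_mul _ _) m)) => [||j].
- by move=> a x y; rewrite !r.
- by move=> a x y; rewrite r.
by rewrite !grp_mul_delta mulgA.
Qed.

Lemma grp_mul1l : left_id grp_one grp_mul.
Proof.
have [l r] := grp_mul_bilin; apply: eq_delta => [a x y|a x y|g] //.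
  by rewrite r.
by rewrite grp_mul_delta mul1g.
Qed.

Lemma grp_mul1r : right_id grp_one grp_mul.
Proof.
have [l r] := grp_mul_bilin.
apply: (eq_delta (p := fun f => grp_mul f _)) => [a x y|a x y|g] //.
  by rewrite l.
by rewrite grp_mul_delta mulg1.
Qed.

Lemma grp_mulDl : left_distributive grp_mul +%R.
Proof. by move=> f k m; have := grp_mul_bilin.1 m 1 f k; rewrite !scale1r. Qed.

Lemma grp_mulDr : right_distributive grp_mul +%R.
Proof. by move=> m f k; have := grp_mul_bilin.2 m 1 f k; rewrite !scale1r. Qed.

Lemma grp_one_neq0 : grp_one != 0.
Proof.
by apply/eqP => /ffunP/(_ 1%g)/eqP; rewrite !ffunE eqxx (oner_eq0 F).
Qed.

HB.instance Definition _ := GRing.Zmodule_isNzRing.Build (grp_alg F gT)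
  grp_mulA grp_mul1l grp_mul1r grp_mulDl grp_mulDr grp_one_neq0.

Lemma grp_scaleAl (a : F) f k : a *: (f * k) = (a *: f) * k.
Proof.
rewrite -[in RHS](addr0 (a *: f)) -[RHS]/(grp_mul _ _) grp_mul_bilin.1.
by rewrite -[grp_mul 0 k]/(0 * k) mul0r addr0.
Qed.

HB.instance Definition _ :=
  GRing.Lmodule_isLalgebra.Build F (grp_alg F gT) grp_scaleAl.

Lemma grp_scaleAr (a : F) f k : a *: (f * k) = f * (a *: k).
Proof.
rewrite -[in RHS](addr0 (a *: k)) -[RHS]/(grp_mul _ _) grp_mul_bilin.2.
by rewrite -[grp_mul f 0]/(f * 0) mulr0 addr0.
Qed.

HB.instance Definition _ :=
  GRing.Lalgebra_isAlgebra.Build F (grp_alg F gT) grp_scaleAr.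

HB.instance Definition _ := Algebra_isFalgebra.Build F (grp_alg F gT).

Definition grp_coprod f : tensor (grp_alg F gT) (grp_alg F gT) :=
  \sum_g (f g : F) *: (grp_delta g \ox grp_delta g).

Definition grp_counit f : F^o := \sum_g f g.

Lemma grp_coprod_linear : linear grp_coprod.
Proof.
move=> a f k; rewrite /grp_coprod scaler_sumr -big_split.
by apply: eq_bigr => g _ /=; rewrite !ffunE scalerDl scalerA.
Qed.

HB.instance Definition _ :=
  GRing.isLinear.Build F _ _ _ grp_coprod grp_coprod_linear.

Lemma grp_counit_linear : linear grp_counit.
Proof.
move=> a f k; rewrite /grp_counit scaler_sumr -big_split.
by apply: eq_bigr => g _ /=; rewrite !ffunE.
Qed.

HB.instance Definition _ :=
  GRing.isLinear.Build F _ _ _ grp_counit grp_counit_linear.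

Lemma grp_coprod_delta g : grp_coprod (grp_delta g) = grp_delta g \ox grp_delta g.
Proof.
rewrite /grp_coprod (bigD1 g) //= big1 => [|h /negPf hg].
  by rewrite ffunE eqxx scale1r addr0.
by rewrite ffunE hg scale0r.
Qed.

Lemma grp_counit_delta g : grp_counit (grp_delta g) = 1.
Proof.
rewrite /grp_counit (bigD1 g) //= big1 => [|h /negPf hg].
  by rewrite ffunE eqxx addr0.
by rewrite ffunE hg.
Qed.

Lemma grp_coprodA f :
  tassoc (tmap grp_coprod idfun (grp_coprod f))
    = tmap idfun grp_coprod (grp_coprod f).
Proof.
move: f; apply: eq_delta => [a x y|a x y|g].
- by rewrite /tassoc /tmap grp_coprod_linear !tlift_linear.
- by rewrite /tmap grp_coprod_linear tlift_linear.
by rewrite grp_coprod_delta !tmap_tens /= grp_coprod_delta tassoc_tens.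
Qed.

Lemma grp_counitl f :
  tlift (fun a b => (grp_counit a : F) *: b) (grp_coprod f) = f.
Proof.
move: f; apply: eq_delta => [a x y|a x y|g] //.
  by rewrite grp_coprod_linear tlift_linear.
rewrite grp_coprod_delta tlift_tens ?grp_counit_delta ?scale1r //.
by split=> u a x y; rewrite !linearP ?scalerDl ?scalerDr ?scalerA // mulrC.
Qed.

Lemma grp_counitr f :
  tlift (fun a b => (grp_counit b : F) *: a) (grp_coprod f) = f.
Proof.
move: f; apply: eq_delta => [a x y|a x y|g] //.
  by rewrite grp_coprod_linear tlift_linear.
rewrite grp_coprod_delta tlift_tens ?grp_counit_delta ?scale1r //.
by split=> u a x y; rewrite !linearP ?scalerDl ?scalerDr ?scalerA // mulrC.
Qed.

HB.instance Definition _ := Vector_isCoalgebra.Build F (grp_alg F gT)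
  grp_coprodA grp_counitl grp_counitr.

Lemma grp_coprodM f k : coprod (f * k) = tmul (coprod f) (coprod k).
Proof.
have [l r] := grp_mul_bilin.
have [l' r'] := @tmul_bilin F (grp_alg F gT) (grp_alg F gT).
apply: (eq_delta (p := fun f => coprod (f * k))
          (q := fun f => tmul (coprod f) (coprod k))) => [||g].
- by move=> a x y; rewrite mulrDl -scalerAl linearP.
- by move=> a x y; rewrite linearP l'.
apply: (eq_delta (p := fun k => coprod (_ * k))
          (q := fun k => tmul _ (coprod k))) => [||h].
- by move=> a x y; rewrite mulrDr -scalerAr linearP.
- by move=> a x y; rewrite linearP r'.
rewrite /coprod /= -[grp_delta g * _]/(grp_mul _ _) grp_mul_delta.
by rewrite !grp_coprod_delta tmul_tens -!grp_mul_delta.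
Qed.

Lemma grp_coprod1 : coprod (1 : grp_alg F gT) = 1 \ox 1.
Proof. exact: grp_coprod_delta. Qed.

Lemma grp_counitM f k : counit (f * k) = counit f * counit k.
Proof.
apply: (eq_delta (p := fun f => counit (f * k) : F^o)
          (q := fun f => counit f * counit k : F^o)) => [||g].
- by move=> a x y; rewrite mulrDl -scalerAl linearP.
- by move=> a x y; rewrite linearP mulrDl -scalerAl.
apply: (eq_delta (p := fun k => counit (_ * k) : F^o)
          (q := fun k => _ * counit k : F^o)) => [||h].
- by move=> a x y; rewrite mulrDr -scalerAr linearP.
- by move=> a x y; rewrite linearP mulrDr -scalerAr.
rewrite /counit /= -[grp_delta g * _]/(grp_mul _ _) grp_mul_delta.
by rewrite !grp_counit_delta mulr1.
Qed.

Lemma grp_counit1 : counit (1 : grp_alg F gT) = 1.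
Proof. exact: grp_counit_delta. Qed.

HB.instance Definition _ := Falgebra_isBialgebra.Build F (grp_alg F gT)
  grp_coprodM grp_coprod1 grp_counitM grp_counit1.

End GroupAlgebra.

(* Main.v *)
Require Import Defs.
From HB Require Import structures.
From mathcomp Require Import all_boot all_fingroup all_algebra falgebra.

Set Implicit Arguments.
Unset Strict Implicit.
Unset Printing Implicit Defensive.

Import GRing.Theory.
Local Open Scope ring_scope.

(** If a bialgebra H of dimension 3 over F_2 has counit eps, then it has a basis
1, x, y with eps(x) = eps(y) = 0.  In the dual basis eps, p, q the algebra H^*
is of the same shape: its unit is eps and evaluation at 1 is multiplicative.
So H is encoded by two augmented multiplication tables, one for H and one for
H^*, with 2^8 values each, and H is determined up to isomorphism by this pair.
Associativity leaves 28 tables; multiplicativity of the coproduct, tested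
against p \ox q, leaves 114 pairs, and these form 24 orbits under the changes
of frame that keep 1 and the kernel of eps, i.e. under GL_2(F_2).  Whatever the
theorem says about H is then read off a representative of its orbit: the two
algebra types by a base change to one of the tables A, ..., G, and the
existence of an antipode by trying the images of x and y. *)

(** * Tensors and the dual algebra *)

(** Tensors are coordinate matrices in bases unrelated to a frame 1, x, y. For a given bialgebra an
    identity between tensors is therefore tested against pairs of functionals, where the coproduct
    turns into the product of H^*. This is why the coproduct is stored as a multiplication table:
    both tables then have the same format, and only the multiplicativity of the coproduct links
    them, through the action of H on H^*. The enumeration alone bounds the number of classes from
    above. Existence needs the converse construction, a bialgebra on F_2^3 built from any valid
    code; distinctness needs that an isomorphism carries a frame and its dual frame to another such
    pair, so that isomorphic bialgebras have codes in one orbit. Algebras are compared by all 24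
    bases starting with 1, since an algebra isomorphism need not respect eps. *)

Section TensorPairing.

Variables (F : fieldType).
Implicit Types (U V : vectType F).

Definition pairing U V (p : U -> F) (q : V -> F) : tensor U V -> F^o :=
  tlift (fun a b => p a * q b : F^o).

HB.instance Definition _ U V (p : U -> F) (q : V -> F) :=
  GRing.isLinear.Build F (tensor U V) F^o _ (pairing p q) (tlift_linear _).

Lemma pairing_tens U V (p : {linear U -> F^o}) (q : {linear V -> F^o}) u v :
  pairing p q (u \ox v) = p u * q v.
Proof. exact/tlift_tens/bilin_mul. Qed.

Lemma dual_mul_pairing (H : bialgType F) (p q : dual_alg H) h :
  (p * q) h = pairing p q (coprod h).
Proof. by rewrite -[p * q]/(dual_mul p q) lfunE. Qed.

Lemma dual_one_counit (H : bialgType F) h : (1 : dual_alg H) h = counit h.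
Proof. by rewrite -[1]/(dual_one H) lfunE. Qed.

(** Paired with the [i]-th and [j]-th coordinate functionals, a tensor returns its entry at
    [(i, j)]. *)
Lemma tensor_ext U V (s t : tensor U V) :
  (forall (p : 'Hom(U, F^o)) (q : 'Hom(V, F^o)), pairing p q s = pairing p q t) ->
  s = t.
Proof.
move=> st; apply/matrixP => i j.
pose p : 'Hom(U, F^o) := linfun (coord (vbasis {:U}) i : U -> F^o).
pose q : 'Hom(V, F^o) := linfun (coord (vbasis {:V}) j : V -> F^o).
suff E r : pairing p q r = r i j by rewrite -!E st.
rewrite /pairing /tlift (bigD1 i) //= [X in _ + X]big1 => [|k /negPf ki].
  rewrite addr0 (bigD1 j) //= [X in _ + X]big1 => [|k /negPf kj].
    rewrite addr0 !lfunE /= !coord_vbasisE !eqxx.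
    by rewrite mulr1 -[_ *: _]/(_ * _) mulr1.
  by rewrite !lfunE /= !coord_vbasisE [j == k]eq_sym kj mulr0 scaler0.
rewrite big1 // => l _.
by rewrite !lfunE /= !coord_vbasisE [i == k]eq_sym ki mul0r scaler0.
Qed.

(** The right action of A on its dual. It moves a left factor [a \ox b] off a tensor and onto the
    functionals, see [pairing_tmul]. *)
Definition dual_act (A : falgType F) (p : 'Hom(A, F^o)) (a : A) : 'Hom(A, F^o) :=
  (p \o amull a)%VF.

Lemma dual_actE (A : falgType F) (p : 'Hom(A, F^o)) (a b : A) :
  dual_act p a b = p (a * b).
Proof. by rewrite lfunE /= lfunE. Qed.

Lemma pairing_tmul (A B : falgType F) (p : 'Hom(A, F^o)) (q : 'Hom(B, F^o))
    a b t :
  pairing p q (tmul (a \ox b) t) = pairing (dual_act p a) (dual_act q b) t.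
Proof.
have tL : linear (tmul (a \ox b)) by move=> k s s'; rewrite (tmul_bilin A B).2.
pose M := GRing.isLinear.Build F _ _ _ (tmul (a \ox b)) tL.
pose T : {linear tensor A B -> tensor A B} := HB.pack (tmul (a \ox b)) M.
apply: (eq_linear_tens (f := pairing p q \o T)) => c d /=.
by rewrite tmul_tens !pairing_tens /= !dual_actE.
Qed.

Variables (H K : bialgType F).

Definition dual_map (f : {linear H -> K}) (p : dual_alg K) : dual_alg H :=
  linfun (p \o f).

Lemma dual_mapE f p h : dual_map f p h = p (f h).
Proof. by rewrite lfunE. Qed.

Lemma pairing_tmap (f : {linear H -> K}) (p q : dual_alg K) t :
  pairing p q (tmap f f t) = pairing (dual_map f p) (dual_map f q) t.
Proof.
rewrite /pairing tlift_tmap; last exact: bilin_mul.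
by apply: eq_tlift => a b; rewrite !dual_mapE.
Qed.

(** Tested against functionals, compatibility with the coproducts is multiplicativity of the
    transpose; compatibility with the counits says that the transpose preserves units. *)
Lemma bialg_iso_dual (f : {lrmorphism H -> K}) :
  bijective f -> {morph dual_map f : p q / p * q} -> dual_map f 1 = 1 ->
  bialg_iso H K.
Proof.
move=> bf fM f1; exists f; split=> // h.
  apply: tensor_ext => p q; rewrite pairing_tmap -!dual_mul_pairing -fM.
  by rewrite dual_mapE dual_mul_pairing.
by rewrite -!dual_one_counit -f1 dual_mapE.
Qed.

Lemma dual_map_morph (f : {linear H -> K}) :
  (forall h, coprod (f h) = tmap f f (coprod h)) ->
  {morph dual_map f : p q / p * q}.
Proof.
move=> fC p q; apply/lfunP => h.
by rewrite dual_mapE !dual_mul_pairing fC pairing_tmap.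
Qed.

Lemma dual_map_one (f : {linear H -> K}) :
  (forall h, counit (f h) = counit h) -> dual_map f 1 = 1.
Proof. by move=> fC; apply/lfunP => h; rewrite dual_mapE !dual_one_counit. Qed.

End TensorPairing.

(** * Coordinates over F_2 *)

(* Coordinates (u_1, u_x, u_y) with respect to a basis 1, x, y. *)
Definition bv : Type := bool * bool * bool.

Definition bvz : bv := (false, false, false).
Definition bvo : bv := (true, false, false).
Definition bvx : bv := (false, true, false).
Definition bvy : bv := (false, false, true).
Definition bvxy : bv := (false, true, true).
Definition basis_bv : seq bv := [:: bvo; bvx; bvy].

Definition bvadd (u v : bv) : bv :=
  let: (a, b, c) := u in let: (a', b', c') := v in (a (+) a', b (+) b', c (+) c').

Definition bvscale (b : bool) (u : bv) : bv := if b then u else bvz.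

Definition bvdot (u v : bv) : bool :=
  let: (a, b, c) := u in let: (a', b', c') := v in
  (a && a') (+) (b && b') (+) (c && c').

Definition bvcomb (a b c u : bv) : bv :=
  let: (i, j, k) := u in bvadd (bvadd (bvscale i a) (bvscale j b)) (bvscale k c).

(* The entries are the products xx, xy, yx, yy. *)
Definition table : Type := bv * bv * bv * bv.

(** The rows belonging to 1, x, y are [v] itself and the left multiplications by x and y read off
    the table, so the unit laws hold for every table. *)
Definition bvmul (t : table) (u v : bv) : bv :=
  bvcomb v (bvcomb bvx t.1.1.1 t.1.1.2 v) (bvcomb bvy t.1.2 t.2 v) u.

Lemma F2_eq (a : 'F_2) : a = (a != 0)%:R.
Proof. by case: a => [[|[|//]] ?]; apply: val_inj. Qed.

Lemma F2_natb_inj : injective (fun b : bool => b%:R : 'F_2).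
Proof. by case=> [] [] /(congr1 val). Qed.

Lemma F2_addb (a b : bool) : (a (+) b)%:R = a%:R + b%:R :> 'F_2.
Proof. by case: a b => [] []; apply: val_inj. Qed.

Lemma F2_andb (a b : bool) : (a && b)%:R = a%:R * b%:R :> 'F_2.
Proof. by case: a b => [] []; apply: val_inj. Qed.

Lemma F2_addrr (V : lmodType 'F_2) (v : V) : v + v = 0.
Proof.
by rewrite -[v]scale1r -scalerDl (_ : 1 + 1 = 0 :> 'F_2) ?scale0r //; apply: val_inj.
Qed.

Lemma F2_linear (U V : lmodType 'F_2) (f : U -> V) :
  {morph f : u v / u + v} -> linear f.
Proof.
move=> fD a u v; rewrite fD (F2_eq a); congr (_ + _); case: (a != 0).
  by rewrite !scale1r.
by rewrite !scale0r -(F2_addrr 0) fD F2_addrr.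
Qed.

(* Locked, as unfolding it in a failing unification problem is very expensive. *)
HB.lock Definition comb (V : lmodType 'F_2) (a b c : V) (u : bv) : V :=
  u.1.1%:R *: a + u.1.2%:R *: b + u.2%:R *: c.

Section Comb.

Variable V : lmodType 'F_2.
Implicit Types (a b c : V) (u v w : bv).

Lemma comb_def a b c u :
  comb a b c u = u.1.1%:R *: a + u.1.2%:R *: b + u.2%:R *: c.
Proof. by rewrite comb.unlock. Qed.

Lemma combD a b c u v : comb a b c (bvadd u v) = comb a b c u + comb a b c v.
Proof.
case: u v => [[? ?] ?] [[? ?] ?].
by rewrite !comb_def /= !F2_addb !scalerDl [RHS]addrACA [X in _ = X + _]addrACA.
Qed.

Lemma combZ a b c k u : comb a b c (bvscale k u) = k%:R *: comb a b c u.
Proof. by case: k; rewrite ?scale1r // scale0r comb_def /= !scale0r !addr0. Qed.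

Lemma comb_bvcomb a b c p q r u :
  comb a b c (bvcomb p q r u)
    = comb (comb a b c p) (comb a b c q) (comb a b c r) u.
Proof. by case: u => [[i j] k]; rewrite !combD !combZ [RHS]comb_def. Qed.

Lemma comb_o a b c : comb a b c bvo = a.
Proof. by rewrite comb_def /= scale1r !scale0r !addr0. Qed.

Lemma comb_x a b c : comb a b c bvx = b.
Proof. by rewrite comb_def /= scale1r !scale0r addr0 add0r. Qed.

Lemma comb_y a b c : comb a b c bvy = c.
Proof. by rewrite comb_def /= scale1r !scale0r !add0r. Qed.

Definition combE := (comb_o, comb_x, comb_y).

Lemma comb_sum (f : bv -> V) u : {morph f : v w / bvadd v w >-> v + w} ->
  f u = \sum_(i <- basis_bv) (bvdot i u)%:R *: f i.
Proof.
move=> fD; have f0 : f bvz = 0.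
  by rewrite -[bvz]/(bvadd bvz bvz) fD F2_addrr.
have -> : f u = comb (f bvo) (f bvx) (f bvy) u.
  have -> : u = bvadd (bvadd (bvscale u.1.1 bvo) (bvscale u.1.2 bvx))
                 (bvscale u.2 bvy) by case: u => [[[] []] []].
  rewrite !fD; case: u => [[a b] c] /=.
  by case: a b c => [] [] []; rewrite !comb_def /= ?f0 ?scale0r ?scale1r.
by rewrite comb_def !big_cons big_nil addr0 addrA; case: u => [[[] []] []].
Qed.

End Comb.

Lemma linear_comb (V W : lmodType 'F_2) (f : {linear V -> W}) a b c u :
  f (comb a b c u) = comb (f a) (f b) (f c) u.
Proof. by rewrite !comb_def !linearD !linearZ. Qed.

Lemma lrmorphism_of (A B : falgType 'F_2) (f : A -> B) :
  {morph f : a b / a + b} -> {morph f : a b / a * b} -> f 1 = 1 ->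
  exists g : {lrmorphism A -> B}, g =1 f.
Proof.
move=> fD fM f1.
pose L := GRing.isLinear.Build 'F_2 A B _ f (F2_linear fD).
pose M := GRing.isMonoidMorphism.Build A B f (f1, fM).
pose g : {lrmorphism A -> B} := HB.pack f L M.
by exists g.
Qed.

(** * Isomorphisms of algebras *)

Section AlgIso.

Variable F : fieldType.
Implicit Types A B C : falgType F.

Lemma alg_iso_sym A B : alg_iso A B -> alg_iso B A.
Proof.
case=> f [g fK gK].
have gL : linear g by move=> k a b; apply: (can_inj fK); rewrite linearP /= !gK.
have gM : monoid_morphism g.
  by split=> [|a b]; apply: (can_inj fK); rewrite gK ?rmorph1 ?rmorphM /= ?gK.
pose L := GRing.isLinear.Build F B A _ g gL.
pose M := GRing.isMonoidMorphism.Build B A g gM.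
by exists (HB.pack_for {lrmorphism B -> A} g L M), f.
Qed.

Lemma alg_iso_trans A B C : alg_iso A B -> alg_iso B C -> alg_iso A C.
Proof.
move=> [f bf] [g bg].
by exists (g \o f : {lrmorphism A -> C}); apply: bij_comp.
Qed.

Lemma alg_iso_dim A B : alg_iso A B -> \dim {:A} = \dim {:B}.
Proof.
case=> f [g fK gK].
have kf : lker (linfun f) == 0%VS.
  by apply/lker0P => a b; rewrite !lfunE => /(can_inj fK).
rewrite -(limg_dim_eq (f := linfun f) (U := fullv)); last first.
  by rewrite (eqP kf) capv0.
congr (\dim _); apply/vspaceP => b; rewrite memvf -[b]gK.
by have := memv_img (linfun f) (memvf (g b)); rewrite lfunE.
Qed.

End AlgIso.

(** * Presentations of algebras by tables *)

Definition all_bv : seq bv :=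
  [seq (ab, c) | ab <- [seq (a, b) | a <- [:: false; true], b <- [:: false; true]],
                 c <- [:: false; true]].

Lemma mem_all_bv u : u \in all_bv.
Proof. by case: u => [[[] []] []]. Qed.

Definition presents (A : falgType 'F_2) (x y : A) (t : table) :=
  bijective (comb 1 x y) /\
  forall u v, comb 1 x y u * comb 1 x y v = comb 1 x y (bvmul t u v).

(** Linear independence of [bvo], [g], [h], phrased by distinctness of the eight combinations so
    that it evaluates. *)
Definition indep (g h : bv) := uniq [seq bvcomb bvo g h u | u <- all_bv].

Definition base_change (t : table) (g h : bv) (t' : table) : bool :=
  let c := bvcomb bvo g h in let: (xx, xy, yx, yy) := t' in
  [&& bvmul t g g == c xx, bvmul t g h == c xy,
      bvmul t h g == c yx & bvmul t h h == c yy].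

Definition pairs_bv : seq (bv * bv) := [seq (g, h) | g <- all_bv, h <- all_bv].

(** The 24 bases of F_2^3 that start with 1: six bases modulo 1, each with four lifts. *)
Definition frames : seq (bv * bv) := [seq p <- pairs_bv | indep p.1 p.2].

Definition alg_related (t t' : table) : bool :=
  has (fun p => base_change t p.1 p.2 t') frames.

Lemma mem_pairs_bv p : p \in pairs_bv.
Proof. by case: p => g h; apply: allpairs_f; apply: mem_all_bv. Qed.

Lemma bvcomb_o a b c : bvcomb a b c bvo = a.
Proof. by case: a => [[[] []] []]. Qed.

Lemma bvcomb_x a b c : bvcomb a b c bvx = b.
Proof. by case: b => [[[] []] []]. Qed.

Lemma bvcomb_y a b c : bvcomb a b c bvy = c.
Proof. by case: c => [[[] []] []]. Qed.

Section BvmulBasis.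

Variables xx xy yx yy : bv.
Let t : table := (xx, xy, yx, yy).

Lemma bvmul_xx : bvmul t bvx bvx = xx. Proof. by rewrite /bvmul !bvcomb_x. Qed.
Lemma bvmul_xy : bvmul t bvx bvy = xy. Proof. by rewrite /bvmul bvcomb_x bvcomb_y. Qed.
Lemma bvmul_yx : bvmul t bvy bvx = yx. Proof. by rewrite /bvmul bvcomb_y bvcomb_x. Qed.
Lemma bvmul_yy : bvmul t bvy bvy = yy. Proof. by rewrite /bvmul !bvcomb_y. Qed.

End BvmulBasis.

Lemma indepP g h : reflect (bijective (bvcomb bvo g h)) (indep g h).
Proof.
have perm : perm_eq all_bv (enum {: bv}).
  by rewrite uniq_perm ?enum_uniq // => u; rewrite mem_enum mem_all_bv.
rewrite /indep (perm_uniq (perm_map _ perm)).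
apply: (iffP (injectiveP _)) => [/injF_bij // | /bij_inj //].
Qed.

Section Presents.

Variable A : falgType 'F_2.
Implicit Types (x y : A) (t : table) (g h : bv).

Lemma presents_products x y xx xy yx yy : bijective (comb 1 x y) ->
  x * x = comb 1 x y xx -> x * y = comb 1 x y xy ->
  y * x = comb 1 x y yx -> y * y = comb 1 x y yy ->
  presents x y (xx, xy, yx, yy).
Proof.
move=> b exx exy eyx eyy; split=> // u v; rewrite /bvmul /= !comb_bvcomb !combE.
rewrite -exx -exy -eyx -eyy [in LHS](comb_def _ _ _ u) [RHS]comb_def.
rewrite !mulrDl -!scalerAl mul1r.
by rewrite !comb_def !mulrDr -!scalerAr !mulr1.
Qed.

Lemma presents_ex x y : bijective (comb 1 x y) -> exists t, presents x y t.
Proof.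
move=> b; case: (b) => c _ cK; exists (c (x * x), c (x * y), c (y * x), c (y * y)).
by apply: presents_products; rewrite ?cK.
Qed.

Lemma comb_basis_bij x y : basis_of {:A} [:: 1; x; y] -> bijective (comb 1 x y).
Proof.
move=> b; pose X := [tuple 1; x; y]; have /basis_free fX : basis_of {:A} X by [].
have E u : comb 1 x y u = \sum_(i < 3) (nth false [:: u.1.1; u.1.2; u.2] i)%:R *: X`_i.
  by rewrite comb_def !big_ord_recl big_ord0 addr0 addrA.
pose c (i : nat) a := coord X (inord i) a != 0.
exists (fun a => (c 0%N a, c 1%N a, c 2%N a)) => [u|a].
  rewrite /c E !coord_sum_free // !inordK //.
  by case: u => [[[] []] []].
rewrite E [RHS](coord_basis b (memvf a)); apply: eq_bigr => i _; congr (_ *: _).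
case: i => [[|[|[|//]]] ?]; rewrite /= /c [RHS]F2_eq; congr (_ != 0)%:R;
  congr (coord _ _ _); apply: val_inj; rewrite /= inordK //.
Qed.

Lemma dim3_frame : \dim {:A} = 3%N -> exists x y, bijective (comb 1 x y).
Proof.
move=> dA; pose U := <[1 : A]>%VS.
have dU : \dim U^C = 2%N.
  have := dimv_compl U; rewrite dA dim_vline oner_neq0 //.
have := vbasisP U^C; case: (vbasis U^C) => s /= /eqP; rewrite dU.
case: s => [|x [|y [|//]]] // _ bC; exists x, y; apply: comb_basis_bij.
rewrite -(addv_complf U) -cat1s; apply: cat_basis => //.
  by rewrite directvEgeq /= addv_complf dim_vline oner_neq0 dU dA.
exact/seq1_basis/oner_neq0.
Qed.

End Presents.

Lemma presents_iso (A B : falgType 'F_2) (x y : A) (x' y' : B) t :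
  presents x y t -> presents x' y' t ->
  exists2 f : {lrmorphism A -> B}, bijective f
    & forall u, f (comb 1 x y u) = comb 1 x' y' u.
Proof.
move=> [[c cK Kc] eM] [[c' c'K Kc'] eM'].
pose f a := comb 1 x' y' (c a).
have fE u : f (comb 1 x y u) = comb 1 x' y' u by rewrite /f cK.
have fD : {morph f : a b / a + b}.
  by move=> a b; rewrite -[a]Kc -[b]Kc -combD !fE combD.
have fM : {morph f : a b / a * b}.
  by move=> a b; rewrite -[a]Kc -[b]Kc eM !fE eM'.
have f1 : f 1 = 1 by rewrite -[in LHS](comb_o 1 x y) fE comb_o.
have [g gE] := lrmorphism_of fD fM f1.
exists g => [|u]; last by rewrite gE fE.
exists (fun b => comb 1 x y (c' b)) => [a|b]; first by rewrite gE /f c'K Kc.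
by rewrite gE fE Kc'.
Qed.

Lemma presents_transfer (A B : falgType 'F_2) (f : {lrmorphism A -> B}) x y t :
  bijective f -> presents x y t -> presents (f x) (f y) t.
Proof.
move=> bf [bc cM].
have E u : comb 1 (f x) (f y) u = f (comb 1 x y u).
  by rewrite linear_comb rmorph1.
split.
  by apply: (eq_bij (f := f \o comb 1 x y)) => [|u]; [exact: bij_comp | rewrite E].
by move=> u v; rewrite !E -rmorphM cM.
Qed.

Section BaseChange.

Variable A : falgType 'F_2.
Implicit Types (x y : A) (t : table) (g h : bv).

Lemma comb_change x y g h u :
  comb 1 (comb 1 x y g) (comb 1 x y h) u = comb 1 x y (bvcomb bvo g h u).
Proof. by rewrite comb_bvcomb comb_o. Qed.

Lemma presents_change x y t g h t' :
  presents x y t -> indep g h -> base_change t g h t' ->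
  presents (comb 1 x y g) (comb 1 x y h) t'.
Proof.
move=> [bc cM] /indepP bgh; case: t' => [[[xx xy] yx] yy] /and4P[].
move=> /eqP exx /eqP exy /eqP eyx /eqP eyy; apply: presents_products.
- apply: (eq_bij (f := comb 1 x y \o bvcomb bvo g h)) => [|u].
    exact: bij_comp.
  by rewrite comb_change.
- by rewrite cM exx -comb_change.
- by rewrite cM exy -comb_change.
- by rewrite cM eyx -comb_change.
by rewrite cM eyy -comb_change.
Qed.

(** The coordinates of the second frame in the first are the change of basis; injectivity of
    [comb 1 x y] turns identities in A into identities of coordinates. *)
Lemma presents_changeP x y t x' y' t' :
  presents x y t -> presents x' y' t' ->
  exists g h, [/\ x' = comb 1 x y g, y' = comb 1 x y h, indep g h
    & base_change t g h t'].
Proof.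
move=> [[c cK Kc] cM] [bc' cM']; exists (c x'), (c y').
have inj := can_inj cK.
have E u : comb 1 x y (bvcomb bvo (c x') (c y') u) = comb 1 x' y' u.
  by rewrite -comb_change !Kc.
rewrite !Kc; split=> //.
  apply/indepP; apply: (eq_bij (f := c \o comb 1 x' y')) => [|u].
    by apply: bij_comp => //; exists (comb 1 x y).
  by rewrite /= -E cK.
move: cM' E; case: t' => [[[xx xy] yx] yy] cM' E.
have M u v : bvmul t (bvcomb bvo (c x') (c y') u) (bvcomb bvo (c x') (c y') v)
    = bvcomb bvo (c x') (c y') (bvmul (xx, xy, yx, yy) u v).
  by apply: inj; rewrite -cM !E cM'.
have := M bvx bvx; have := M bvx bvy; have := M bvy bvx; have := M bvy bvy.
rewrite bvmul_xx bvmul_xy bvmul_yx bvmul_yy !bvcomb_x !bvcomb_y /base_change.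
by move=> -> -> -> ->; rewrite !eqxx.
Qed.

End BaseChange.

(** An isomorphism carries the frame of B into A, so both tables become tables of a single algebra
    and differ by a change of frame. Isomorphism is thereby decided by evaluation. *)
Lemma alg_iso_related (A B : falgType 'F_2) (x y : A) (x' y' : B) t t' :
  presents x y t -> presents x' y' t' -> alg_iso A B <-> alg_related t t'.
Proof.
move=> pA pB; split=> [/alg_iso_sym[f bf] | ].
  have [g [h [_ _ i b]]] := presents_changeP pA (presents_transfer bf pB).
  by apply/hasP; exists (g, h); rewrite // mem_filter i mem_pairs_bv.
case/hasP=> -[g h] /=; rewrite mem_filter => /andP[i _] b.
by have [f bf _] := presents_iso (presents_change pA i b) pB; exists f.
Qed.

(** * The seven algebras as tables *)

Definition std_table (n : alg_name) : table :=
  match n with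
  | nA => (bvz, bvz, bvz, bvz)
  | nB => (bvx, bvz, bvz, bvy)
  | nC => (bvx, bvz, bvz, bvz)
  | nD => (bvy, bvxy, bvxy, bvx)
  | nE => (bvy, bvz, bvz, bvz)
  | nF => (bvy, bvadd bvo bvy, bvadd bvo bvy, bvadd bvo bvxy)
  | nG => (bvx, bvy, bvz, bvz)
  end.

Definition row_bv : bv -> 'rV['F_2]_3 := comb (vec3 1 0 0) (vec3 0 1 0) (vec3 0 0 1).

Definition bv_row (r : 'rV['F_2]_3) : bv :=
  (r 0 0 != 0, r 0 1 != 0, r 0 (Ordinal (isT : 2 < 3)%N) != 0).

Lemma row_bvE u : row_bv u = vec3 u.1.1%:R u.1.2%:R u.2%:R.
Proof.
rewrite /row_bv comb_def; apply/rowP => [[[|[|[|//]]] ?]]; rewrite !mxE /=.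
- by rewrite mulr1 !mulr0 !addr0.
- by rewrite mulr1 !mulr0 addr0 add0r.
by rewrite mulr1 !mulr0 !add0r.
Qed.

Lemma row_bvK : cancel row_bv bv_row.
Proof. by move=> u; rewrite row_bvE /bv_row !mxE /=; case: u => [[[] []] []]. Qed.

Lemma bv_rowK : cancel bv_row row_bv.
Proof.
move=> r; rewrite row_bvE; apply/rowP => [[[|[|[|//]]] ?]]; rewrite !mxE /= -F2_eq;
  by congr (r _ _); apply: val_inj.
Qed.

Lemma alg3_combE n u :
  comb (1 : alg3 n) (vec3 0 1 0 : alg3 n) (vec3 0 0 1 : alg3 n) u = row_bv u.
Proof. by []. Qed.

Lemma alg3_presents n :
  presents (vec3 0 1 0 : alg3 n) (vec3 0 0 1 : alg3 n) (std_table n).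
Proof.
pose e (i : 'I_3) : alg3 n := delta_mx 0 i.
pose i2 : 'I_3 := Ordinal (isT : 2 < 3)%N.
have eM i j : e i * e j = nth 0 (nth [::] (alg_table n) i) j := alg3_mulE n i j.
have ex : vec3 0 1 0 = e 1.
  by apply/rowP => [[[|[|[|//]]] ?]]; rewrite !mxE.
have ey : vec3 0 0 1 = e i2.
  by apply/rowP => [[[|[|[|//]]] ?]]; rewrite !mxE.
rewrite (_ : std_table n = ((std_table n).1.1.1, (std_table n).1.1.2,
  (std_table n).1.2, (std_table n).2)); last by case: n {eM ex ey e}.
apply: presents_products.
- by exists bv_row; [exact: row_bvK | exact: bv_rowK].
all: rewrite alg3_combE row_bvE ?ex ?ey eM.
all: case: n {eM ex ey e} => /=; apply/rowP => [[[|[|[|//]]] ?]].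
all: by rewrite !mxE; apply: val_inj.
Qed.

(** * Codes of bialgebras *)

(* The tables of H and of H^* with respect to dual bases. *)
Definition code : Type := table * table.

Definition basis_all (P : pred bv) : bool := all P basis_bv.

Definition basis_xor (f : bv -> bool) : bool :=
  foldr (fun i b => f i (+) b) false basis_bv.

Definition assoc_at (t : table) (u v w : bv) : bool :=
  bvmul t (bvmul t u v) w == bvmul t u (bvmul t v w).

(* The coefficient of i \ox j in the coproduct of w. *)
Definition cop (d : table) (w i j : bv) : bool := bvdot (bvmul d i j) w.

(* The functional k |-> p (i k). *)
Definition bvact (m : table) (p i : bv) : bv :=
  (bvdot p (bvmul m i bvo), bvdot p (bvmul m i bvx), bvdot p (bvmul m i bvy)).

(* The pairing of p \ox q with coprod (a b) = coprod a * coprod b. *)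
Definition compat_at (c : code) (a b p q : bv) : bool :=
  cop c.2 (bvmul c.1 a b) p q ==
  basis_xor (fun i => basis_xor (fun j => cop c.2 a i j &&
    bvdot (bvmul c.2 (bvact c.1 p i) (bvact c.1 q j)) b)).

(** In a frame with eps(x) = eps(y) = 0 the first coordinate is eps; in the dual frame it is
    evaluation at 1. *)
Definition augmented_at (t : table) (u v : bv) : bool :=
  (bvmul t u v).1.1 == u.1.1 && v.1.1.

Definition valid (c : code) : bool :=
  [&& basis_all (fun u => basis_all (fun v => basis_all (assoc_at c.1 u v))),
      basis_all (fun u => basis_all (fun v => basis_all (assoc_at c.2 u v))),
      basis_all (fun u => basis_all (augmented_at c.1 u)),
      basis_all (fun u => basis_all (augmented_at c.2 u))
    & basis_all (fun a => basis_all (fun b => basis_all (fun p =>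
        basis_all (compat_at c a b p))))].

(* The span of x and y, i.e. the kernel of the augmentation. *)
Definition aug_bv : seq bv := [:: bvz; bvx; bvy; bvxy].
Definition aug_basis : seq bv := [:: bvx; bvy].

(** An augmentation kernel is closed under products, so the four entries lie in the span of x and y,
    which leaves 4^4 tables. Associativity with 1 among the factors is automatic. *)
Definition aug_tables : seq table :=
  [seq t : table <- [seq (abc, d) | abc <- [seq (ab, c) |
                       ab <- [seq (a, b) | a <- aug_bv, b <- aug_bv],
                       c <- aug_bv], d <- aug_bv]
   | all (fun u => all (fun v => all (assoc_at t u v) aug_basis) aug_basis)
       aug_basis].

(** Only a necessary condition, imposed on x, y and the dual vectors p, q; the chosen
    representatives are tested against the full [valid] in [valid_reps]. *)
Definition compat_code (c : code) : bool :=
  all (fun a => all (fun b => all (fun p => all (compat_at c a b p)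
    aug_basis) aug_basis) aug_basis) aug_basis.

(** The two bases are dual to each other. As both start with [bvo], duality forces the other vectors
    into the kernel of the augmentation, and one basis determines the other: this leaves the six
    elements of GL_2(F_2). *)
Definition dual_frame (p q : bv * bv) : bool :=
  all (fun u => all (fun w =>
    bvdot (bvcomb bvo q.1 q.2 u) (bvcomb bvo p.1 p.2 w) == bvdot u w)
  basis_bv) basis_bv.

Definition dual_frames : seq (bv * bv * (bv * bv)) :=
  [seq G <- [seq (p, q) | p <- frames, q <- frames] | dual_frame G.1 G.2].

Definition code_related (c c' : code) : bool :=
  has (fun G : bv * bv * (bv * bv) => base_change c.1 G.1.1 G.1.2 c'.1
    && base_change c.2 G.2.1 G.2.2 c'.2) dual_frames.

Definition hopf_names (X Y : alg_name) : bool :=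
  match X, Y with nB, nD | nD, nB => true | _, _ => false end.

(* Any valid code: the default value of nth on the sequences reps X Y. *)
Definition code0 : code := ((bvx, bvz, bvz, bvy), (bvx, bvy, bvy, bvy)).

(** The first table fixes H as an algebra with counit. B and D need one such table each: the three
    characters of B are permuted by automorphisms, and D has a single character. C and G have two
    characters with non-isomorphic kernels, hence two first tables. *)
Definition reps (X Y : alg_name) : seq code :=
  match X, Y with
  | nB, nB => [:: ((bvx, bvz, bvz, bvy), (bvx, bvy, bvy, bvy))]
  | nB, nC => [:: ((bvx, bvz, bvz, bvy), (bvz, bvx, bvx, bvy));
      ((bvx, bvz, bvz, bvy), (bvy, bvy, bvy, bvy));
      ((bvx, bvz, bvz, bvy), (bvy, bvx, bvx, bvy))]
  | nB, nD => [:: ((bvx, bvz, bvz, bvy), (bvy, bvxy, bvxy, bvx))]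
  | nB, nG => [:: ((bvx, bvz, bvz, bvy), (bvx, bvy, bvx, bvy));
      ((bvx, bvz, bvz, bvy), (bvx, bvx, bvy, bvy))]
  | nC, nB => [:: ((bvz, bvz, bvz, bvy), (bvx, bvx, bvx, bvy));
      ((bvz, bvx, bvx, bvy), (bvx, bvz, bvz, bvy));
      ((bvz, bvx, bvx, bvy), (bvx, bvx, bvx, bvy))]
  | nC, nC => [:: ((bvz, bvz, bvz, bvy), (bvz, bvx, bvx, bvy));
      ((bvz, bvx, bvx, bvy), (bvz, bvz, bvz, bvy));
      ((bvz, bvx, bvx, bvy), (bvz, bvx, bvx, bvy))]
  | nC, nG => [:: ((bvz, bvx, bvx, bvy), (bvz, bvz, bvx, bvy));
      ((bvz, bvx, bvx, bvy), (bvz, bvx, bvz, bvy))]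
  | nD, nB => [:: ((bvy, bvxy, bvxy, bvx), (bvx, bvz, bvz, bvy))]
  | nD, nG => [:: ((bvy, bvxy, bvxy, bvx), (bvx, bvy, bvx, bvy));
      ((bvy, bvxy, bvxy, bvx), (bvx, bvx, bvy, bvy))]
  | nG, nB => [:: ((bvz, bvz, bvx, bvy), (bvx, bvx, bvx, bvy));
      ((bvz, bvx, bvz, bvy), (bvx, bvx, bvx, bvy))]
  | nG, nC => [:: ((bvz, bvz, bvx, bvy), (bvz, bvx, bvx, bvy));
      ((bvz, bvx, bvz, bvy), (bvz, bvx, bvx, bvy))]
  | nG, nD => [:: ((bvz, bvz, bvx, bvy), (bvxy, bvx, bvx, bvy));
      ((bvz, bvx, bvz, bvy), (bvxy, bvx, bvx, bvy))]
  | _, _ => [::]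
  end.

Definition alg_names := [:: nA; nB; nC; nD; nE; nF; nG].

Lemma alg_names_all (P : pred alg_name) : all P alg_names -> forall X, P X.
Proof. by do 7 case/andP=> ?; move=> _ []. Qed.

Lemma has_ex (T : Type) (P : pred T) s : has P s -> exists x, P x.
Proof. by elim: s => //= x s IH /orP[Px|/IH //]; exists x. Qed.

(** The convolution product of [s] and [s'] at [w], in coordinates. *)
Definition bvconv (c : code) (s s' : bv -> bv) (w : bv) : bv :=
  foldr bvadd bvz [seq bvmul c.1 (s ij.1) (s' ij.2)
    | ij <- [seq (i, j) | i <- basis_bv, j <- basis_bv] & cop c.2 w ij.1 ij.2].

Definition antipode_code (c : code) (s : bv -> bv) : bool :=
  all (fun w => (bvconv c s id w == bvscale w.1.1 bvo)
    && (bvconv c id s w == bvscale w.1.1 bvo)) basis_bv.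

(* An antipode fixes 1, so only the images of x and y are unknown. *)
Definition hopf_code (c : code) : bool :=
  has (fun p => antipode_code c (bvcomb bvo p.1 p.2)) pairs_bv.

(** * Exhaustive checks *)

Lemma size_reps X Y : size (reps X Y) = bialg_count X Y.
Proof. by case: X Y => [] []. Qed.

Lemma aug_tables_reps : all (fun m => all (fun d => compat_code (m, d) ==>
    has (fun X => has (fun Y => has (code_related (m, d)) (reps X Y)) alg_names)
      alg_names)
  aug_tables) aug_tables.
Proof. by vm_compute. Qed.

Lemma valid_reps :
  all (fun X => all (fun Y => all valid (reps X Y)) alg_names) alg_names.
Proof. by vm_compute. Qed.

Lemma reps_type : all (fun X => all (fun Y => all (fun c : code =>
    alg_related c.1 (std_table X) && alg_related c.2 (std_table Y)) (reps X Y))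
  alg_names) alg_names.
Proof. by vm_compute. Qed.

Lemma reps_unrelated : all (fun X => all (fun Y =>
    let r := reps X Y in let k := iota 0 (size r) in
    all (fun i => all (fun j =>
      code_related (nth code0 r i) (nth code0 r j) ==> (i == j)) k) k)
  alg_names) alg_names.
Proof. by vm_compute. Qed.

Lemma reps_hopf : all (fun X => all (fun Y => all (fun c =>
    hopf_code c == hopf_names X Y) (reps X Y)) alg_names) alg_names.
Proof. by vm_compute. Qed.

(** None of the 24 frames relates two different tables among the seven, which makes the types
    mutually exclusive. *)
Lemma std_table_related X Y : alg_related (std_table X) (std_table Y) -> X = Y.
Proof. by case: X Y => [] [] //; vm_compute. Qed.

(** * The coordinate pairing and dual frames *)

Lemma bvdotDr k u v : bvdot k (bvadd u v) = bvdot k u (+) bvdot k v.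
Proof.
case: k u v => [[? ?] ?] [[? ?] ?] [[? ?] ?] /=.
by rewrite !andb_addr [RHS]addbACA [X in _ = X (+) _]addbACA.
Qed.

Lemma bvdotC u v : bvdot u v = bvdot v u.
Proof.
by case: u v => [[a b] c] [[? ?] ?] /=; rewrite (andbC a) (andbC b) (andbC c).
Qed.

Lemma natb_scaleAC (a b c : bool) :
  a%:R *: (b%:R *: (c%:R : ('F_2)^o)) = c%:R *: (a%:R * b%:R : ('F_2)^o).
Proof. by case: a b c => [] [] []; apply: val_inj. Qed.

Lemma bvdotZl k u v : bvdot (bvscale k u) v = k && bvdot u v.
Proof. by case: k => //; case: v => [[? ?] ?]. Qed.

(** This computes the transpose of [bvcomb a b c] for the dot product. *)
Lemma bvdot_bvcomb a b c u v :
  bvdot (bvcomb a b c u) v = bvdot u (bvdot a v, bvdot b v, bvdot c v).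
Proof.
case: u => [[i j] k]; rewrite bvdotC !bvdotDr ![bvdot v _]bvdotC.
by rewrite !bvdotZl.
Qed.

Lemma dual_frameP p q : reflect (forall u w,
    bvdot (bvcomb bvo q.1 q.2 u) (bvcomb bvo p.1 p.2 w) = bvdot u w)
  (dual_frame p q).
Proof.
apply: (iffP idP) => [D u w|E]; last first.
  by apply/allP => u _; apply/allP => w _; rewrite E.
have {}D i j : i \in basis_bv -> j \in basis_bv ->
    bvdot (bvcomb bvo q.1 q.2 i) (bvcomb bvo p.1 p.2 j) = bvdot i j.
  by move=> Hi Hj; apply/eqP; have /allP/(_ _ Hi)/allP/(_ _ Hj) := D.
have E i : i \in basis_bv ->
    bvdot (bvcomb bvo q.1 q.2 i) (bvcomb bvo p.1 p.2 w) = bvdot i w.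
  move=> Hi; rewrite bvdotC bvdot_bvcomb.
  have := (D i bvo Hi isT, D i bvx Hi isT, D i bvy Hi isT).
  rewrite bvcomb_o bvcomb_x bvcomb_y ![bvdot _ (bvcomb _ _ _ i)]bvdotC.
  case=> [[-> ->] ->]; rewrite [RHS]bvdotC; congr bvdot.
  by case: i {Hi} => [[[] []] []].
rewrite bvdot_bvcomb; have := (E bvo isT, E bvx isT, E bvy isT).
rewrite bvcomb_o bvcomb_x bvcomb_y; case=> [[-> ->] ->]; congr bvdot.
by case: w {E} => [[[] []] []].
Qed.

Lemma mem_dual_frames p q : ((p, q) \in dual_frames) =
  [&& dual_frame p q, indep p.1 p.2 & indep q.1 q.2].
Proof.
have F r : (r \in frames) = indep r.1 r.2 by rewrite mem_filter mem_pairs_bv andbT.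
rewrite mem_filter; congr (_ && _).
apply/allpairsP/andP => [[[a b] [+ + [-> ->]]]|[ip iq]]; first by rewrite !F.
by exists (p, q); rewrite !F.
Qed.

Lemma additive_ext (V : lmodType 'F_2) (f g : bv -> V) :
  {morph f : u v / bvadd u v >-> u + v} -> {morph g : u v / bvadd u v >-> u + v} ->
  {in basis_bv, f =1 g} -> f =1 g.
Proof.
move=> fD gD fg u; rewrite (comb_sum u fD) (comb_sum u gD).
by apply: eq_big_seq => i /fg ->.
Qed.

Lemma bilin_mulr (F : fieldType) (U V : vectType F) (A : falgType F)
    (f : {linear U -> A}) (g : {linear V -> A}) :
  bilin (fun a b => f a * g b).
Proof.
split=> x a y z; rewrite linearP; first by rewrite mulrDl -scalerAl.
by rewrite mulrDr -scalerAr.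
Qed.

Lemma basis_xorE f : (basis_xor f)%:R = \sum_(i <- basis_bv) (f i)%:R :> 'F_2.
Proof. by rewrite !big_cons big_nil /basis_xor /= !F2_addb. Qed.

Lemma comb_F2 (a b c : ('F_2)^o) u :
  comb a b c u = (bvdot u (a != 0, b != 0, c != 0))%:R.
Proof.
rewrite comb_def {1}(F2_eq a) {1}(F2_eq b) {1}(F2_eq c).
by case: u (a != 0) (b != 0) (c != 0) => [[[] []] []] [] [] []; apply: val_inj.
Qed.

Lemma comb_lfunE (V W : vectType 'F_2) (f g h : 'Hom(V, W)) u a :
  comb f g h u a = comb (f a) (g a) (h a) u.
Proof. by rewrite !comb_def !add_lfunE !scale_lfunE. Qed.

(** * Bialgebras with a given code *)

(** Since the unit of H^* is the counit, the case [u = bvo] contains eps(x) = eps(y) = 0, and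
    [w = bvo] says that p and q vanish at 1. *)
Definition dual_pair (H : bialgType 'F_2) (x y : H) (p q : dual_alg H) :=
  forall u w, comb 1 p q u (comb 1 x y w) = (bvdot u w)%:R.

Definition bipresents (H : bialgType 'F_2) (x y : H) (p q : dual_alg H) (c : code) :=
  [/\ presents x y c.1, presents p q c.2 & dual_pair x y p q].

Section Bipresents.

Variables (H : bialgType 'F_2).
Implicit Types (x y : H) (p q f : dual_alg H) (c : code) (u v w i j : bv).

Lemma dual_combE x y p q f : bijective (comb 1 x y) -> dual_pair x y p q ->
  f = comb 1 p q (f 1 != 0, f x != 0, f y != 0).
Proof.
move=> [c _ Kc] d; apply/lfunP => a; rewrite -[a]Kc d linear_comb.
rewrite comb_F2; congr (_%:R); case: (c a) => [[? ?] ?] /=.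
by rewrite ![_ && (f _ != 0)]andbC.
Qed.

Lemma dual_comb_bij x y p q :
  bijective (comb 1 x y) -> dual_pair x y p q -> bijective (comb 1 p q).
Proof.
move=> b d; exists (fun f => (f 1 != 0, f x != 0, f y != 0)) => [u|f].
  have := d u bvo; have := d u bvx; have := d u bvy; rewrite !combE => -> -> ->.
  by case: u => [[[] []] []].
by rewrite -(dual_combE f b d).
Qed.

(** The coordinate functionals of x and y serve as p and q; eps completes them to the dual basis
    because it vanishes on x and y. *)
Lemma dual_pair_ex x y : bijective (comb 1 x y) -> counit x = 0 -> counit y = 0 ->
  exists p q, dual_pair x y p q.
Proof.
move=> [c cK Kc] ex ey.
have cD a b : c (a + b) = bvadd (c a) (c b).
  by apply: (can_inj cK); rewrite combD !Kc.
pose f (k : bv) (a : H) : ('F_2)^o := (bvdot k (c a))%:R.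
have fD k : {morph f k : a b / a + b}.
  by move=> a b; rewrite /f cD bvdotDr -[RHS]F2_addb.
pose L k : {linear H -> ('F_2)^o} :=
  HB.pack (f k) (GRing.isLinear.Build 'F_2 _ _ _ (f k) (F2_linear (fD k))).
exists (linfun (L bvx)), (linfun (L bvy)) => u w.
rewrite comb_lfunE dual_one_counit !lfunE /= linear_comb ex ey counit1 /f cK.
rewrite (_ : comb _ _ _ w = (bvdot bvo w)%:R); last first.
  by rewrite comb_def; case: w => [[[] []] []]; apply: val_inj.
by rewrite comb_F2; congr (bvdot u _)%:R; case: w => [[[] []] []].
Qed.

(* Adding eps(x) 1 to x and eps(y) 1 to y moves them to the kernel of eps. *)
Lemma bipresents_ex x y : bijective (comb 1 x y) ->
  exists x y p q c, @bipresents H x y p q c.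
Proof.
move=> b; pose g : bv := (counit x != 0, true, false).
pose h : bv := (counit y != 0, false, true).
have igh : indep g h by rewrite /g /h; case: (_ != _); case: (_ != _).
have {}b : bijective (comb 1 (comb 1 x y g) (comb 1 x y h)).
  apply: (eq_bij (f := comb 1 x y \o bvcomb bvo g h)) => [|u].
    by apply: bij_comp => //; apply/indepP.
  by rewrite comb_change.
have [||p [q d]] := dual_pair_ex b.
- rewrite linear_comb counit1 comb_F2 /g.
  by case: (counit x != 0); apply: val_inj.
- rewrite linear_comb counit1 comb_F2 /h.
  by case: (counit y != 0); rewrite /= ?andbF; apply: val_inj.
have [m pm] := presents_ex b; have [t pt] := presents_ex (dual_comb_bij b d).
by exists (comb 1 x y g), (comb 1 x y h), p, q, (m, t).
Qed.

Variables (x y : H) (p q : dual_alg H) (c : code).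
Hypothesis Hc : bipresents x y p q c.
Let ex := comb 1 x y.
Let ep := comb 1 p q.

Let epD u v : ep (bvadd u v) = ep u + ep v. Proof. exact: combD. Qed.

Let exM u v : ex u * ex v = ex (bvmul c.1 u v).
Proof. by case: Hc => [[]]. Qed.

Let epM u v : ep u * ep v = ep (bvmul c.2 u v).
Proof. by case: Hc => [_ []]. Qed.

Let epx u w : ep u (ex w) = (bvdot u w)%:R.
Proof. by case: Hc. Qed.

Let dualE f : exists u, f = ep u.
Proof.
case: Hc => [[b _] _ d]; exists (f 1 != 0, f x != 0, f y != 0).
exact: dual_combE.
Qed.

(** By duality a coefficient of the coproduct is the value at [ex w] of a product of two dual basis
    vectors. Both sides are compared on pairs of functionals, each a combination of 1, p, q, and the
    product in H^* is expanded bilinearly. *)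
Lemma coprod_comb w : coprod (ex w) =
  \sum_(i <- basis_bv) \sum_(j <- basis_bv) (cop c.2 w i j)%:R *: (ex i \ox ex j).
Proof.
apply: tensor_ext => f g; have [u ->] := dualE f; have [v ->] := dualE g.
rewrite -dual_mul_pairing linear_sum.
pose F u v : ('F_2)^o := (ep u * ep v : dual_alg H) (ex w).
have Fl b : {morph F^~ b : a a' / bvadd a a' >-> a + a'}.
  by move=> a a'; rewrite /F epD mulrDl add_lfunE.
have Fr a : {morph F a : b b' / bvadd b b' >-> b + b'}.
  by move=> b b'; rewrite /F epD mulrDr add_lfunE.
rewrite -[LHS]/(F u v) (comb_sum u (Fl v)); apply: eq_bigr => i _.
rewrite linear_sum (comb_sum v (Fr i)) scaler_sumr; apply: eq_bigr => j _.
rewrite [RHS]linearZ /= pairing_tens /F /= epM.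
rewrite (epx (bvmul c.2 i j) w) (epx u i) (epx v j) (bvdotC u) (bvdotC v).
exact: natb_scaleAC.
Qed.

Let dual_act_comb u i : dual_act (ep u) (ex i) = ep (bvact c.1 u i).
Proof.
case: Hc => [[b _] _ d]; rewrite [LHS](dual_combE _ b d) !dual_actE.
have E k z : ex k = z -> ep u (ex i * z) = (bvdot u (bvmul c.1 i k))%:R.
  by move=> <-; rewrite exM epx.
rewrite (E _ _ (comb_o 1 x y)) (E _ _ (comb_x 1 x y)) (E _ _ (comb_y 1 x y)).
by rewrite /bvact; do 3 case: (bvdot _ _).
Qed.

(** Expand the coproduct of the first factor, let [ex i] and [ex j] act on the functionals, and read
    the remaining pairing with the coproduct of the second factor as a product in H^*: the identity
    then involves only the two tables. *)
Lemma compat_bipresents a b u v : compat_at c a b u v.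
Proof.
apply/eqP/F2_natb_inj.
have -> : (cop c.2 (bvmul c.1 a b) u v)%:R
    = (ep u * ep v : dual_alg H) (ex a * ex b).
  by rewrite exM epM epx.
rewrite dual_mul_pairing coprodM coprod_comb basis_xorE.
pose R (s : tensor H H) : ('F_2)^o := pairing (ep u) (ep v) (tmul s (coprod (ex b))).
have RL : linear R by move=> k s s'; rewrite /R (tmul_bilin H H).1 linearP.
pose T : {linear tensor H H -> ('F_2)^o} :=
  HB.pack R (GRing.isLinear.Build 'F_2 _ _ _ R RL).
have TE s : T s = R s by [].
rewrite -[LHS]TE linear_sum; apply: eq_bigr => i _.
rewrite basis_xorE linear_sum; apply: eq_bigr => j _.
by rewrite linearZ TE /R pairing_tmul !dual_act_comb -dual_mul_pairing epM epx F2_andb.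
Qed.

Lemma valid_bipresents : valid c.
Proof.
have inj : injective ex by case: Hc => [[/bij_inj]].
have injp : injective ep by case: Hc => [_ [/bij_inj]].
have ex1 w : (1 : dual_alg H) (ex w) = w.1.1%:R.
  by rewrite -(comb_o 1 p q) [LHS]epx; case: w => [[[] []] []].
have ep1 u : ep u 1 = u.1.1%:R.
  by rewrite -(comb_o 1 x y) [LHS]epx; case: u => [[[] []] []].
apply/and5P; split; apply/allP => u _; apply/allP => v _; try (apply/allP => w _).
- by apply/eqP/inj; rewrite -!exM mulrA.
- by apply/eqP/injp; rewrite -!epM mulrA.
- apply/eqP/F2_natb_inj; rewrite -ex1 -exM F2_andb -!ex1 !dual_one_counit.
  exact: counitM.
(* The element 1 is grouplike, so evaluation at 1 is multiplicative on H^*. *)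
- apply/eqP/F2_natb_inj; rewrite -ep1 -epM F2_andb -!ep1 dual_mul_pairing coprod1.
  exact: pairing_tens.
by apply/allP => z _; apply: compat_bipresents.
Qed.

Lemma bipresents_change c' : code_related c c' ->
  exists x y p q, @bipresents H x y p q c'.
Proof.
case/hasP=> -[[g1 g2] [h1 h2]]; rewrite mem_dual_frames.
case/and3P=> /dual_frameP D ig ih /andP[bg bh].
case: Hc => px pp d; have pg := presents_change px ig bg.
exists (ex g1), (ex g2), (ep h1), (ep h2); split=> // [|u w].
  exact: presents_change pp ih bh.
by rewrite (comb_change p q) (comb_change x y) d (D u w).
Qed.

(** H and H^* give one change of frame each; these are dual to each other because both the old and
    the new frames are dual pairs. *)
Lemma bipresents_changeP x' y' p' q' c' :
  @bipresents H x' y' p' q' c' -> code_related c c'.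
Proof.
case: Hc => px pp d [px' pp' d'].
have [g1 [g2 [e1 e2 ig bg]]] := presents_changeP px px'.
have [h1 [h2 [e3 e4 ih bh]]] := presents_changeP pp pp'.
apply/hasP; exists ((g1, g2), (h1, h2)); last by apply/andP.
rewrite mem_dual_frames; apply/and3P; split=> //; apply/dual_frameP => u w.
by apply: F2_natb_inj; rewrite -d -d' -!comb_change e1 e2 e3 e4.
Qed.

Lemma conv_comb (S S' : {linear H -> H}) s s' w :
  (forall i, S (ex i) = ex (s i)) -> (forall i, S' (ex i) = ex (s' i)) ->
  tlift (fun a b => S a * S' b) (coprod (ex w)) = ex (bvconv c s s' w).
Proof.
move=> sE sE'; rewrite coprod_comb /bvconv.
have -> l : ex (foldr bvadd bvz l) = \sum_(u <- l) ex u.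
  elim: l => [|u l IH]; last by rewrite big_cons -IH [LHS]combD.
  by rewrite big_nil /ex comb_def !scale0r !addr0.
rewrite big_map big_filter [RHS]big_mkcond big_allpairs linear_sum.
apply: eq_bigr => i _; rewrite linear_sum; apply: eq_bigr => j _ /=.
rewrite linearZ /= tlift_tens; last exact: bilin_mulr.
by rewrite sE sE' exM; case: (cop _ _ _ _); rewrite ?scale1r ?scale0r.
Qed.

Lemma counit_comb w : (counit (ex w) : 'F_2) *: (1 : H) = ex (bvscale w.1.1 bvo).
Proof.
rewrite -dual_one_counit -(comb_o 1 p q) (epx bvo w) -(comb_o 1 x y).
by rewrite [RHS]combZ; case: w => [[[] []] []].
Qed.

Lemma is_hopf_code : is_hopf H <-> hopf_code c.
Proof.
have [b cK Kc] : bijective ex by case: Hc => [[]].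
split=> [[S [Sl Sr]]|].
  (* At the grouplike element 1 the left antipode identity reads S(1) 1 = 1. *)
  have S1 : S 1 = 1.
    have := Sl 1; rewrite coprod1 tlift_tens; last exact: (bilin_mulr S idfun).
    by rewrite mulr1 counit1 scale1r.
  have SE i : S (ex i) = ex (bvcomb bvo (b (S x)) (b (S y)) i).
    rewrite linear_comb S1 [RHS]comb_bvcomb comb_o.
    by rewrite -[comb 1 x y (b _)]/(ex _) -[comb 1 x y (b (S y))]/(ex _) !Kc.
  apply/hasP; exists (b (S x), b (S y)); first exact: mem_pairs_bv.
  apply/allP => w _; apply/andP; split; apply/eqP/(can_inj cK); rewrite -counit_comb.
    by rewrite -Sl -(conv_comb (S' := idfun) w SE).
  by rewrite -Sr -(conv_comb (S := idfun) w _ SE).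
case/hasP=> -[p1 p2] _ /allP /= chk; pose s := bvcomb bvo p1 p2.
have sD u v : ex (s (bvadd u v)) = ex (s u) + ex (s v).
  by rewrite /ex /s !comb_bvcomb combD.
have bD a a' : b (a + a') = bvadd (b a) (b a').
  by apply: (can_inj cK); rewrite [RHS]combD -!/(ex _) !Kc.
pose f a := ex (s (b a)).
have fD : {morph f : a a' / a + a'} by move=> a a'; rewrite /f bD sD.
pose S : {linear H -> H} := HB.pack f (GRing.isLinear.Build _ _ _ _ f (F2_linear fD)).
have SE i : S (ex i) = ex (s i) by rewrite /= /f cK.
(* Both sides are linear in h, so the identities checked on the basis suffice. *)
have ext (T : {linear tensor H H -> H}) :
    (forall w, w \in basis_bv -> T (coprod (ex w)) = (counit (ex w) : 'F_2) *: 1) ->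
    forall h, T (coprod h) = (counit h : 'F_2) *: 1.
  move=> E h; rewrite -[h]Kc.
  move: (b h); apply: additive_ext => // u v; rewrite [ex _]combD ?linearD //.
  by rewrite scalerDl.
exists S; split.
  apply: (ext (tlift (fun a b => S a * b))) => w /chk/andP[/eqP e _].
  by rewrite counit_comb -e -(conv_comb (S' := idfun) w SE).
apply: (ext (tlift (fun a b => a * S b))) => w /chk/andP[_ /eqP e].
by rewrite counit_comb -e -(conv_comb (S := idfun) w _ SE).
Qed.

End Bipresents.

(** * Codes and isomorphisms of bialgebras *)

Definition has_code (H : bialgType 'F_2) (c : code) :=
  exists x y p q, @bipresents H x y p q c.

Section CodeIso.

Variables H K : bialgType 'F_2.

Lemma dual_map_comb (f : {linear H -> K}) (p q r : dual_alg K) u :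
  dual_map f (comb p q r u) = comb (dual_map f p) (dual_map f q) (dual_map f r) u.
Proof.
by apply/lfunP => h; rewrite dual_mapE !comb_lfunE !dual_mapE.
Qed.

(** Equality of the first tables makes the linear map between the frames an algebra map. Its
    transpose takes dual frame to dual frame, so equality of the second tables makes it a coalgebra
    map. *)
Lemma has_code_iso c : has_code H c -> has_code K c -> bialg_iso H K.
Proof.
move=> [x [y [p [q [px pp d]]]]] [x' [y' [p' [q' [px' pp' d']]]]].
have [f bf fE] := presents_iso px px'.
have fD u : dual_map f (comb 1 p' q' u) = comb 1 p q u.
  case: px => [[b bK Kb] _]; apply/lfunP => h; rewrite -[h]Kb dual_mapE /= fE.
  by rewrite d d'.
apply: (bialg_iso_dual bf); last by rewrite -{1}(comb_o 1 p' q') fD comb_o.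
move=> r s; case: pp' => [[b' bK' Kb'] M']; rewrite -[r]Kb' -[s]Kb' M' !fD.
by case: pp => _ ->.
Qed.

(** The frame is pulled back along the inverse of the isomorphism, the dual frame along its
    transpose. *)
Lemma has_code_transfer c : bialg_iso H K -> has_code K c -> has_code H c.
Proof.
move=> [f [bf fC fe]] [x' [y' [p' [q' [px' pp' d']]]]].
case: (bf) => g fK gK; have finj := can_inj fK.
have E u : f (comb 1 (g x') (g y') u) = comb 1 x' y' u.
  by rewrite linear_comb rmorph1 /= !gK.
have D u : comb 1 (dual_map f p') (dual_map f q') u = dual_map f (comb 1 p' q' u).
  by rewrite dual_map_comb dual_map_one.
have b : bijective (comb 1 (g x') (g y')).
  case: px' => [bc _]; apply: (eq_bij (f := g \o comb 1 x' y')) => [|u].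
    by apply: bij_comp => //; exists f.
  by apply: finj; rewrite /= gK E.
have d : dual_pair (g x') (g y') (dual_map f p') (dual_map f q').
  by move=> u w; rewrite D dual_mapE /= E d'.
exists (g x'), (g y'), (dual_map f p'), (dual_map f q'); split=> //.
  split=> // u v; apply: finj; rewrite rmorphM /= !E.
  by case: px' => _ ->.
split=> [|u v]; first exact: dual_comb_bij d.
by rewrite !D -dual_map_morph //; case: pp' => _ ->.
Qed.

End CodeIso.

Lemma mem_aug_bv u : u.1.1 = false -> u \in aug_bv.
Proof. by case: u => [[[] []] []]. Qed.

Lemma all_aug (P : pred bv) : basis_all P -> all P aug_basis.
Proof. by case/andP. Qed.

(** Multiplicativity of the first coordinate puts the products of x and y into the kernel, so each
    table occurs in the enumeration. *)
Lemma valid_aug_tables c : valid c ->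
  [/\ c.1 \in aug_tables, c.2 \in aug_tables & compat_code c].
Proof.
have aug t : basis_all (fun u => basis_all (augmented_at t u)) ->
    basis_all (fun u => basis_all (fun v => basis_all (assoc_at t u v))) ->
    t \in aug_tables.
  case: t => [[[xx xy] yx] yy] /all_aug/and3P[/all_aug/and3P[axx axy _]].
  case/all_aug/and3P=> ayx ayy _ _ Ha; rewrite mem_filter; apply/andP; split.
    apply/allP => u Hu; apply/allP => v Hv; apply: all_aug.
    by have /all_aug/allP/(_ _ Hu)/all_aug/allP/(_ _ Hv) := Ha.
  move: axx axy ayx ayy; rewrite /augmented_at bvmul_xx bvmul_xy bvmul_yx bvmul_yy.
  do 4 move=> /eqP/mem_aug_bv ?.
  by do 3! [apply: allpairs_f => //].
case/and5P=> a1 a2 g1 g2 cc; split; [exact: aug | exact: aug |].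
apply/allP => a Ha; apply/allP => b Hb; apply/allP => p Hp; apply: all_aug.
by have /all_aug/allP/(_ _ Ha)/all_aug/allP/(_ _ Hb)/all_aug/allP/(_ _ Hp) := cc.
Qed.

(** * The bialgebra with a given valid code *)

Lemma row_bvD u v : row_bv (bvadd u v) = row_bv u + row_bv v.
Proof. exact: combD. Qed.

Lemma bv_rowD r s : bv_row (r + s) = bvadd (bv_row r) (bv_row s).
Proof. by apply: (can_inj row_bvK); rewrite row_bvD !bv_rowK. Qed.

Lemma row_bv_inj : injective row_bv. Proof. exact: can_inj row_bvK. Qed.

Lemma bvmulDl t u v w : bvmul t (bvadd u v) w = bvadd (bvmul t u w) (bvmul t v w).
Proof. by apply: row_bv_inj; rewrite row_bvD /row_bv /bvmul !comb_bvcomb combD. Qed.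

Lemma bvmulDr t u v w : bvmul t u (bvadd v w) = bvadd (bvmul t u v) (bvmul t u w).
Proof.
have combDD (a b c a' b' c' : 'rV['F_2]_3) :
    comb (a + a') (b + b') (c + c') u = comb a b c u + comb a' b' c' u.
  by rewrite !comb_def !scalerDr [RHS]addrACA [X in _ = X + _]addrACA.
by apply: row_bv_inj; rewrite row_bvD /row_bv /bvmul !comb_bvcomb -!combDD !combD.
Qed.

Lemma bvmul1l t u : bvmul t bvo u = u.
Proof. exact: bvcomb_o. Qed.

Lemma bvmul1r t u : bvmul t u bvo = u.
Proof. by rewrite /bvmul !bvcomb_o; case: u => [[[] []] []]. Qed.

Lemma bv_additive_ext (f g : bv -> bv) :
  {morph f : u v / bvadd u v} -> {morph g : u v / bvadd u v} ->
  {in basis_bv, f =1 g} -> f =1 g.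
Proof.
move=> fD gD fg u; apply: row_bv_inj; move: u.
by apply: additive_ext => [u v|u v|u /fg -> //]; rewrite ?fD ?gD row_bvD.
Qed.

Lemma basis_bvmulA t :
  basis_all (fun u => basis_all (fun v => basis_all (assoc_at t u v))) ->
  associative (bvmul t).
Proof.
move=> A u v w; move: u; apply: bv_additive_ext => [a b|a b|u Hu].
- by rewrite bvmulDl.
- by rewrite !bvmulDl.
move: v; apply: bv_additive_ext => [a b|a b|v Hv].
- by rewrite bvmulDl bvmulDr.
- by rewrite bvmulDr bvmulDl.
move: w; apply: bv_additive_ext => [a b|a b|w Hw].
- by rewrite !bvmulDr.
- by rewrite bvmulDr.
by have /allP/(_ _ Hu)/allP/(_ _ Hv)/allP/(_ _ Hw)/eqP := A.
Qed.

Lemma basis_augmented t : basis_all (fun u => basis_all (augmented_at t u)) ->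
  forall u v, (bvmul t u v).1.1 = u.1.1 && v.1.1.
Proof.
have addb0 u v : (bvadd u v).1.1 = u.1.1 (+) v.1.1.
  by case: u v => [[? ?] ?] [[? ?] ?].
move=> A u v; apply: F2_natb_inj.
pose f u v : ('F_2)^o := (bvmul t u v).1.1%:R.
pose g (u v : bv) : ('F_2)^o := (u.1.1 && v.1.1)%:R.
rewrite -/(f u v) -/(g u v).
move: u; apply: (additive_ext (f := f^~ v) (g := g^~ v)) => [a b|a b|u Hu].
- by rewrite /f bvmulDl addb0 F2_addb.
- by rewrite /g addb0 andb_addl F2_addb.
move: v; apply: (additive_ext (f := f u) (g := g u)) => [a b|a b|v Hv].
- by rewrite /f bvmulDr addb0 F2_addb.
- by rewrite /g addb0 andb_addr F2_addb.
by have /allP/(_ _ Hu)/allP/(_ _ Hv)/eqP := A; rewrite /f /g => ->.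
Qed.

(** The duality between the coproduct and the product of functionals, obtained by expanding the
    product of [u] and [v] bilinearly. *)
Lemma cop_sum t u v w :
  \sum_(i <- basis_bv) \sum_(j <- basis_bv)
    (cop t w i j)%:R * ((bvdot u i)%:R * (bvdot v j)%:R)
  = (bvdot (bvmul t u v) w)%:R :> 'F_2.
Proof.
pose f u v : ('F_2)^o := (bvdot (bvmul t u v) w)%:R.
have fl a : {morph f^~ a : u v / bvadd u v >-> u + v}.
  by move=> a' b; rewrite /f bvmulDl bvdotC bvdotDr F2_addb ![bvdot w _]bvdotC.
have fr a : {morph f a : u v / bvadd u v >-> u + v}.
  by move=> a' b; rewrite /f bvmulDr bvdotC bvdotDr F2_addb ![bvdot w _]bvdotC.
rewrite -/(f u v) (comb_sum u (fl v)); apply: eq_bigr => i _.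
rewrite (comb_sum v (fr i)) scaler_sumr; apply: eq_bigr => j _.
by rewrite (bvdotC u) (bvdotC v) natb_scaleAC.
Qed.

(** The proof [cv] is a parameter of the type, so that the instances attached to this alias can draw
    their axioms from it. *)
Definition code_alg (c : code) (cv : valid c) := 'rV['F_2]_3.

Section CodeBialgebra.

Variables (c : code) (cv : valid c).
Local Notation A := (code_alg cv).

HB.instance Definition _ := Vector.on A.

Let mA : associative (bvmul c.1).
Proof. by case/and5P: cv => /basis_bvmulA. Qed.

Let dA : associative (bvmul c.2).
Proof. by case/and5P: cv => _ /basis_bvmulA. Qed.

Let m_aug : forall u v, (bvmul c.1 u v).1.1 = u.1.1 && v.1.1.
Proof. by case/and5P: cv => _ _ /basis_augmented. Qed.

Let d_aug : forall u v, (bvmul c.2 u v).1.1 = u.1.1 && v.1.1.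
Proof. by case/and5P: cv => _ _ _ /basis_augmented. Qed.

Definition code_mul (r s : A) : A := row_bv (bvmul c.1 (bv_row r) (bv_row s)).
Definition code_one : A := row_bv bvo.

Lemma code_mulA : associative code_mul.
Proof. by move=> r s t; rewrite /code_mul !row_bvK mA. Qed.

Lemma code_mul1l : left_id code_one code_mul.
Proof. by move=> r; rewrite /code_mul row_bvK bvmul1l bv_rowK. Qed.

Lemma code_mul1r : right_id code_one code_mul.
Proof. by move=> r; rewrite /code_mul row_bvK bvmul1r bv_rowK. Qed.

Lemma code_mulDl : left_distributive code_mul +%R.
Proof. by move=> r s t; rewrite /code_mul bv_rowD bvmulDl row_bvD. Qed.

Lemma code_mulDr : right_distributive code_mul +%R.
Proof. by move=> r s t; rewrite /code_mul bv_rowD bvmulDr row_bvD. Qed.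

Lemma code_one_neq0 : code_one != 0.
Proof. by apply/eqP => /rowP/(_ 0)/eqP; rewrite /code_one row_bvE !mxE. Qed.

HB.instance Definition _ := GRing.Zmodule_isNzRing.Build A
  code_mulA code_mul1l code_mul1r code_mulDl code_mulDr code_one_neq0.

Lemma code_scaleAl (a : 'F_2) (r s : A) : a *: (r * s) = (a *: r) * s.
Proof. by rewrite (F2_eq a); case: (a != 0); rewrite ?scale1r // !scale0r mul0r. Qed.

HB.instance Definition _ := GRing.Lmodule_isLalgebra.Build 'F_2 A code_scaleAl.

Lemma code_scaleAr (a : 'F_2) (r s : A) : a *: (r * s) = r * (a *: s).
Proof. by rewrite (F2_eq a); case: (a != 0); rewrite ?scale1r // !scale0r mulr0. Qed.

HB.instance Definition _ := GRing.Lalgebra_isAlgebra.Build 'F_2 A code_scaleAr.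

HB.instance Definition _ := Algebra_isFalgebra.Build 'F_2 A.

Let e (u : bv) : A := row_bv u.

Let eM u v : e u * e v = e (bvmul c.1 u v).
Proof. by rewrite -[LHS]/(code_mul _ _) /code_mul !row_bvK. Qed.

Let eD u v : e (bvadd u v) = e u + e v. Proof. exact: row_bvD. Qed.

Definition pairs_basis : seq (bv * bv) := [seq (i, j) | i <- basis_bv, j <- basis_bv].

Lemma sum_pairs_basis (V : nmodType) (f : bv * bv -> V) :
  \sum_(k <- pairs_basis) f k = \sum_(i <- basis_bv) \sum_(j <- basis_bv) f (i, j).
Proof. exact: big_allpairs. Qed.

Definition code_coprod (r : A) : tensor A A :=
  \sum_(k <- pairs_basis) (cop c.2 (bv_row r) k.1 k.2)%:R *:
    ((row_bv k.1 : A) \ox (row_bv k.2 : A)).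

Definition code_counit (r : A) : ('F_2)^o := (bv_row r).1.1%:R.

Let copD w w' i j : cop c.2 (bvadd w w') i j = cop c.2 w i j (+) cop c.2 w' i j.
Proof. exact: bvdotDr. Qed.

Lemma code_coprod_linear : linear code_coprod.
Proof.
apply: F2_linear => r s; rewrite /code_coprod -big_split; apply: eq_bigr => k _.
by rewrite bv_rowD copD F2_addb scalerDl.
Qed.

HB.instance Definition _ :=
  GRing.isLinear.Build 'F_2 A (tensor A A) _ code_coprod code_coprod_linear.

Lemma code_counit_linear : linear code_counit.
Proof.
apply: F2_linear => r s; rewrite /code_counit bv_rowD.
by case: (bv_row r) (bv_row s) => [[? ?] ?] [[? ?] ?]; rewrite F2_addb.
Qed.

HB.instance Definition _ :=
  GRing.isLinear.Build 'F_2 A ('F_2)^o _ code_counit code_counit_linear.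

Let coprodE w : code_coprod (e w) =
  \sum_(k <- pairs_basis) (cop c.2 w k.1 k.2)%:R *: (e k.1 \ox e k.2).
Proof. by rewrite /code_coprod row_bvK. Qed.

(** Applying the coproduct to the left factor amounts to multiplying two indices in the second
    table. Together with [cop_actr] this reduces coassociativity to associativity of that table. *)
Let cop_actl w a b j :
  \sum_(i <- basis_bv) (cop c.2 w i j)%:R * (cop c.2 i a b)%:R
  = (cop c.2 w (bvmul c.2 a b) j)%:R :> 'F_2.
Proof.
pose f u : ('F_2)^o := (cop c.2 w u j)%:R.
have fD : {morph f : u v / bvadd u v >-> u + v}.
  by move=> u v; rewrite /f /cop bvmulDl bvdotC bvdotDr F2_addb ![bvdot w _]bvdotC.
rewrite -/(f _) (comb_sum _ fD); apply: eq_bigr => i _.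
by rewrite {2}/cop (bvdotC i) mulrC.
Qed.

Let cop_actr w i a b :
  \sum_(j <- basis_bv) (cop c.2 w i j)%:R * (cop c.2 j a b)%:R
  = (cop c.2 w i (bvmul c.2 a b))%:R :> 'F_2.
Proof.
pose f u : ('F_2)^o := (cop c.2 w i u)%:R.
have fD : {morph f : u v / bvadd u v >-> u + v}.
  by move=> u v; rewrite /f /cop bvmulDr bvdotC bvdotDr F2_addb ![bvdot w _]bvdotC.
rewrite -/(f _) (comb_sum _ fD); apply: eq_bigr => j _.
by rewrite {2}/cop (bvdotC j) mulrC.
Qed.

Let code_coprodA_e w :
  tassoc (tmap code_coprod (@idfun A) (code_coprod (e w)))
  = tmap (@idfun A) code_coprod (code_coprod (e w)).
Proof.
pose T i j k := e i \ox (e j \ox e k).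
have lL : linear (fun t : tensor A A => tassoc (tmap code_coprod (@idfun A) t)).
  by move=> a s t; rewrite /tassoc /tmap !tlift_linear.
have lR : linear (tmap (@idfun A) code_coprod) := tlift_linear _.
have [_ rT] := @tens_bilin _ A (tensor A A).
have [lT _] := @tens_bilin _ (tensor A A) A.
have EL i j : tassoc (tmap code_coprod (@idfun A) (e i \ox e j))
    = \sum_(k <- pairs_basis) (cop c.2 i k.1 k.2)%:R *: T k.1 k.2 j.
  rewrite tmap_tens /= coprodE (linear_sumE (lT _)) linear_sum.
  by apply: eq_bigr => k _; rewrite linearZ /= tassoc_tens.
have ER i j : tmap (@idfun A) code_coprod (e i \ox e j)
    = \sum_(k <- pairs_basis) (cop c.2 j k.1 k.2)%:R *: T i k.1 k.2.
  by rewrite tmap_tens /= coprodE (linear_sumE (rT _)).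
rewrite {1 2}coprodE (linear_sumE lL) (linear_sumE lR).
under eq_bigr do rewrite EL scaler_sumr.
under [RHS]eq_bigr do rewrite ER scaler_sumr.
apply: etrans (sum_pairs_basis _) _; apply: etrans _ (esym (sum_pairs_basis _)).
(* In this common form the coefficient at a, b, j is the pairing of w with (a b) j; the right-hand
   side yields a (b j). *)
transitivity (\sum_(a <- basis_bv) \sum_(b <- basis_bv) \sum_(j <- basis_bv)
    (cop c.2 w (bvmul c.2 a b) j)%:R *: T a b j).
  under eq_bigr do under eq_bigr do rewrite sum_pairs_basis.
  rewrite exchange_big /=.
  under eq_bigr do rewrite exchange_big /=.
  rewrite exchange_big /=; apply: eq_bigr => a _.
  under eq_bigr do rewrite exchange_big /=.
  rewrite exchange_big /=; apply: eq_bigr => b _; apply: eq_bigr => j _.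
  rewrite -cop_actl scaler_suml; apply: eq_bigr => i _.
  by rewrite scalerA.
apply: eq_bigr => i _.
under [RHS]eq_bigr do rewrite sum_pairs_basis.
rewrite [RHS]exchange_big; apply: eq_bigr => a _.
rewrite [RHS]exchange_big; apply: eq_bigr => b _ /=.
under [RHS]eq_bigr do rewrite scalerA.
by rewrite -scaler_suml cop_actr /cop dA.
Qed.

Lemma code_coprodA (r : A) :
  tassoc (tmap code_coprod (@idfun A) (code_coprod r))
  = tmap (@idfun A) code_coprod (code_coprod r).
Proof. by rewrite -[r]bv_rowK; apply: code_coprodA_e. Qed.

Let bilinl : bilin (fun a b : A => (code_counit a : 'F_2) *: b).
Proof. by split=> u a r s; rewrite !linearP ?scalerDl ?scalerDr ?scalerA // mulrC. Qed.

Let bilinr : bilin (fun a b : A => (code_counit b : 'F_2) *: a).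
Proof. by split=> u a r s; rewrite !linearP ?scalerDl ?scalerDr ?scalerA // mulrC. Qed.

Let counit_e w : code_counit (e w) = w.1.1%:R.
Proof. by rewrite /code_counit row_bvK. Qed.

Lemma code_counitl (r : A) :
  tlift (fun a b => (code_counit a : 'F_2) *: b) (code_coprod r) = r.
Proof.
rewrite -[r]bv_rowK; move: (bv_row r) => w; rewrite [in LHS]coprodE.
rewrite (linear_sumE (@tlift_linear _ _ _ _ _)).
under eq_bigr do rewrite (tlift_tens _ _ bilinl) counit_e.
rewrite (comb_sum w row_bvD) !big_cons !big_nil /= !scale1r !scale0r !scaler0 !addr0.
by rewrite /cop !bvmul1l.
Qed.

Lemma code_counitr (r : A) :
  tlift (fun a b => (code_counit b : 'F_2) *: a) (code_coprod r) = r.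
Proof.
rewrite -[r]bv_rowK; move: (bv_row r) => w; rewrite [in LHS]coprodE.
rewrite (linear_sumE (@tlift_linear _ _ _ _ _)).
under eq_bigr do rewrite (tlift_tens _ _ bilinr) counit_e.
rewrite (comb_sum w row_bvD) !big_cons !big_nil /= !scale1r !scale0r !scaler0 !add0r !addr0.
by rewrite /cop !bvmul1r.
Qed.

HB.instance Definition _ := Vector_isCoalgebra.Build 'F_2 A
  code_coprodA code_counitl code_counitr.

Let coprodE_e w : coprod (e w) =
  \sum_(k <- pairs_basis) (cop c.2 w k.1 k.2)%:R *: (e k.1 \ox e k.2).
Proof. exact: coprodE. Qed.

Let e_sum u : e u = \sum_(i <- basis_bv) (bvdot i u)%:R *: e i.
Proof. exact: comb_sum. Qed.

Let tens_sum u v : e u \ox e v = \sum_(k <- pairs_basis)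
  ((bvdot k.1 u)%:R * (bvdot k.2 v)%:R) *: (e k.1 \ox e k.2).
Proof.
have [l r] := @tens_bilin _ A A.
rewrite sum_pairs_basis {1}(e_sum u) (linear_sumE (l _)); apply: eq_bigr => i _.
rewrite {1}(e_sum v) (linear_sumE (r _)) scaler_sumr; apply: eq_bigr => j _.
by rewrite scalerA.
Qed.

Let compat_c a b p q : a \in basis_bv -> b \in basis_bv -> p \in basis_bv ->
  q \in basis_bv -> compat_at c a b p q.
Proof.
move=> Ha Hb Hp Hq; case/and5P: cv => _ _ _ _.
by move=> /allP/(_ _ Ha)/allP/(_ _ Hb)/allP/(_ _ Hp)/allP/(_ _ Hq).
Qed.

Let bvactE p i k : bvdot p (bvmul c.1 i k) = bvdot (bvact c.1 p i) k.
Proof.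
pose f k : ('F_2)^o := (bvdot p (bvmul c.1 i k))%:R.
pose g k : ('F_2)^o := (bvdot (bvact c.1 p i) k)%:R.
apply: F2_natb_inj; rewrite -/(f k) -/(g k).
move: k; apply: (additive_ext (f := f) (g := g)) => [u v|u v|k].
- by rewrite /f bvmulDr bvdotDr F2_addb.
- by rewrite /g bvdotDr F2_addb.
rewrite /f /g /bvact => Hk; congr (_%:R); move: Hk.
by rewrite !inE => /or3P[] /eqP-> /=; rewrite ?andbT ?andbF ?addbF ?addFb.
Qed.

Let coprodM_e a b : a \in basis_bv -> b \in basis_bv ->
  coprod (e a * e b) = tmul (coprod (e a)) (coprod (e b)).
Proof.
move=> Ha Hb; have [l r] := @tmul_bilin _ A A.
rewrite eM !coprodE_e (linear_sumE (l _)).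
transitivity (\sum_(pq <- pairs_basis) (\sum_(k <- pairs_basis) \sum_(k' <- pairs_basis)
   (cop c.2 a k.1 k.2)%:R * ((cop c.2 b k'.1 k'.2)%:R *
     ((bvdot pq.1 (bvmul c.1 k.1 k'.1))%:R * (bvdot pq.2 (bvmul c.1 k.2 k'.2))%:R)))
   *: (e pq.1 \ox e pq.2)); last first.
  under eq_bigr do rewrite scaler_suml.
  rewrite exchange_big; apply: eq_bigr => k _.
  under eq_bigr do rewrite scaler_suml.
  rewrite exchange_big (linear_sumE (r _)) scaler_sumr; apply: eq_bigr => k' _.
  rewrite tmul_tens !eM tens_sum !scaler_sumr; apply: eq_bigr => pq _.
  by rewrite -!scalerA.
apply: eq_big_seq => pq /allpairsP[[p q] [/= Hp Hq ->]] /=; congr (_ *: _).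
(* This is the equality of the coefficients at p, q, once [cop_sum] expands the product of the two
   functionals on b. *)
have /eqP -> := compat_c Ha Hb Hp Hq.
rewrite sum_pairs_basis basis_xorE; apply: eq_bigr => i _.
rewrite basis_xorE; apply: eq_bigr => j _; cbn [fst snd].
rewrite F2_andb -mulr_sumr; congr (_ * _); rewrite -cop_sum sum_pairs_basis.
apply: eq_bigr => k _; apply: eq_bigr => m _; cbn [fst snd].
by rewrite !bvactE.
Qed.

Lemma code_coprodM (r s : A) : coprod (r * s) = tmul (coprod r) (coprod s).
Proof.
have [l r'] := @tmul_bilin _ A A.
rewrite -[r]bv_rowK -[s]bv_rowK; move: (bv_row s) => v.
move: (bv_row r); apply: (additive_ext (f := fun u => coprod (e u * e v))
  (g := fun u => tmul (coprod (e u)) (coprod (e v)))) => [a b|a b|u Hu].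
- by rewrite eD mulrDl linearD.
- by rewrite eD linearD -[coprod (e a)]scale1r l !scale1r.
move: v; apply: (additive_ext (f := fun v => coprod (e u * e v))
  (g := fun v => tmul (coprod (e u)) (coprod (e v)))) => [a b|a b|v Hv].
- by rewrite eD mulrDr linearD.
- by rewrite eD linearD -[coprod (e a)]scale1r r' !scale1r.
exact: coprodM_e.
Qed.

(** A coefficient of the coproduct of 1 is the first coordinate of a product in the second table, so
    the augmentation of that table decides it. *)
Lemma code_coprod1 : coprod (1 : A) = 1 \ox 1.
Proof.
have dot1 u : bvdot u bvo = u.1.1 by case: u => [[[] []] []].
rewrite -[1]/(e bvo) coprodE_e tens_sum; apply: eq_bigr => k _.
by rewrite /cop !dot1 d_aug F2_andb.
Qed.

Lemma code_counitM (r s : A) : counit (r * s) = counit r * counit s.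
Proof.
have E w : counit (e w) = w.1.1%:R by apply: counit_e.
by rewrite -[r]bv_rowK -[s]bv_rowK eM !E m_aug F2_andb.
Qed.

Lemma code_counit1 : counit (1 : A) = 1.
Proof. exact: (counit_e bvo). Qed.

HB.instance Definition _ := Falgebra_isBialgebra.Build 'F_2 A
  code_coprodM code_coprod1 code_counitM code_counit1.

Lemma code_alg_has_code : has_code A c.
Proof.
have E u : comb (1 : A) (e bvx) (e bvy) u = e u.
  by rewrite [RHS]e_sum !big_cons big_nil addr0 addrA comb_def; case: u => [[[] []] []].
have b : bijective (comb (1 : A) (e bvx) (e bvy)).
  by exists bv_row => u; rewrite E; [exact: row_bvK | exact: bv_rowK].
have [p [q d]] := dual_pair_ex b (counit_e bvx) (counit_e bvy).
exists (e bvx), (e bvy), p, q; split=> //; first by split=> // u v; rewrite !E eM.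
split=> [|u v]; first exact: dual_comb_bij d.
have dE u' w : comb 1 p q u' (e w) = (bvdot u' w)%:R by rewrite -E d.
apply/lfunP => r; rewrite -[r]bv_rowK; move: (bv_row r) => w.
rewrite dE dual_mul_pairing coprodE_e linear_sum sum_pairs_basis -cop_sum.
apply: eq_bigr => i _; apply: eq_bigr => j _.
by rewrite linearZ /= pairing_tens /= !dE.
Qed.

End CodeBialgebra.

(** * The classification *)

Lemma repsP (P : alg_name -> alg_name -> pred code) :
  all (fun X => all (fun Y => all (P X Y) (reps X Y)) alg_names) alg_names ->
  forall X Y c, c \in reps X Y -> P X Y c.
Proof. by move=> /alg_names_all A X Y; move/alg_names_all: (A X) => /(_ Y)/allP. Qed.

Lemma dim_alg3 X : \dim {:alg3 X} = 3%N.
Proof. by rewrite dimvf /dim. Qed.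

Lemma alg3_inj X Y : alg_iso (alg3 X) (alg3 Y) -> X = Y.
Proof.
by move/(alg_iso_related (alg3_presents X) (alg3_presents Y))/std_table_related.
Qed.

Lemma dim3_rep (H : bialgType 'F_2) : \dim {:H} = 3%N ->
  exists X Y, exists2 c, c \in reps X Y & has_code H c.
Proof.
move=> /dim3_frame[x [y /bipresents_ex[{}x [{}y [p [q [[m d] Hc]]]]]]].
have [am ad cc] := valid_aug_tables (valid_bipresents Hc).
have /allP/(_ _ am)/allP/(_ _ ad)/implyP/(_ cc) := aug_tables_reps.
case/has_ex=> X /has_ex[Y /hasP[c Yc r]]; exists X, Y, c => //.
exact: bipresents_change Hc _ r.
Qed.

Lemma rep_of_type (H : bialgType 'F_2) X Y c :
  c \in reps X Y -> has_code H c -> of_type (alg3 X) (alg3 Y) H.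
Proof.
move=> /(repsP reps_type)/andP[m d] [x [y [p [q [pm pd _]]]]]; split.
  exact/(alg_iso_related pm (alg3_presents X)).
exact/(alg_iso_related pd (alg3_presents Y)).
Qed.

(** The representative supplied by [dim3_rep] could a priori belong to another type; [alg3_inj]
    excludes this. *)
Lemma of_type_rep (H : bialgType 'F_2) X Y : of_type (alg3 X) (alg3 Y) H ->
  exists2 c, c \in reps X Y & has_code H c.
Proof.
case=> HX HY; have [|X' [Y' [c Xc Hc]]] := @dim3_rep H.
  by rewrite (alg_iso_dim HX) dim_alg3.
have [HX' HY'] := rep_of_type Xc Hc.
have <- : X' = X by apply: alg3_inj; apply: alg_iso_trans (alg_iso_sym HX') HX.
have <- : Y' = Y by apply: alg3_inj; apply: alg_iso_trans (alg_iso_sym HY') HY.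
by exists c.
Qed.

Lemma reps_count X Y c : c \in reps X Y -> (0 < bialg_count X Y)%N.
Proof. by rewrite -size_reps; case: (reps X Y). Qed.

Lemma rep_valid X Y (i : 'I_(bialg_count X Y)) : valid (nth code0 (reps X Y) i).
Proof.
by apply: (repsP valid_reps (X := X) (Y := Y)); rewrite mem_nth ?size_reps.
Qed.

Lemma num_iso_classes_count X Y :
  num_iso_classes (of_type (alg3 X) (alg3 Y)) (bialg_count X Y).
Proof.
exists (fun i => code_alg (rep_valid i)); split=> [i|i j ij|H /of_type_rep[c Xc Hc]].
- apply: (rep_of_type _ (code_alg_has_code _)).
  by rewrite mem_nth ?size_reps.
(* An isomorphism gives the [i]-th bialgebra the [j]-th code as well, so the two codes lie in one
   orbit. *)
- have [x [y [p [q Hi]]]] := code_alg_has_code (rep_valid i).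
  have := has_code_transfer ij (code_alg_has_code (rep_valid j)).
  case=> [x' [y' [p' [q' Hj]]]]; have r := bipresents_changeP Hi Hj.
  apply: val_inj; apply/eqP.
  have := reps_unrelated => /alg_names_all/(_ X)/alg_names_all/(_ Y).
  move=> /allP/(_ i); rewrite mem_iota size_reps ltn_ord => /(_ isT).
  by move=> /allP/(_ j); rewrite mem_iota ltn_ord => /(_ isT)/implyP/(_ r).
have [o oc] : exists o : 'I_(bialg_count X Y), nth code0 (reps X Y) o = c.
  have lt_c : (index c (reps X Y) < bialg_count X Y)%N by rewrite -size_reps index_mem.
  by exists (Ordinal lt_c); apply: nth_index.
by rewrite -oc in Hc; exists o; apply: (has_code_iso Hc); apply: code_alg_has_code.
Qed.

(** With a single representative, all bialgebras of the type share its code. *)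
Lemma bialg_iso_unique (K H : bialgType 'F_2) X Y : bialg_count X Y = 1%N ->
  of_type (alg3 X) (alg3 Y) K -> of_type (alg3 X) (alg3 Y) H <-> bialg_iso H K.
Proof.
rewrite -size_reps => r1 /of_type_rep[c Xc Kc]; split=> [/of_type_rep[c' Xc' Hc]|HK].
  apply: has_code_iso Hc _; case: (reps X Y) Xc Xc' r1 => [|a [|//]] //.
  by rewrite !inE => /eqP<- /eqP->.
exact: rep_of_type Xc (has_code_transfer HK Kc).
Qed.

Lemma hopf_type (H : bialgType 'F_2) : \dim {:H} = 3%N ->
  is_hopf H <-> of_type (alg3 nB) (alg3 nD) H \/ of_type (alg3 nD) (alg3 nB) H.
Proof.
have hopfE X Y c : c \in reps X Y -> has_code H c -> is_hopf H <-> hopf_names X Y.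
  move=> /(repsP reps_hopf)/eqP E [x [y [p [q Hc]]]].
  by rewrite -E; apply: is_hopf_code Hc.
case/dim3_rep=> X [Y [c Xc Hc]]; split.
  move/(hopfE _ _ _ Xc Hc); have := rep_of_type Xc Hc.
  by case: X Y {Xc} => [] []; auto.
by case=> /of_type_rep[c' Xc' Hc']; apply/(hopfE _ _ _ Xc' Hc').
Qed.

(** * The Hopf algebras of the group of order 3 *)

Section Antipodes.

Variables (F : fieldType) (gT : finGroupType).

(** It serves as antipode on both Hopf algebras, which have this same carrier. *)
Definition inv_ffun (f : {ffun gT -> F^o}) : {ffun gT -> F^o} :=
  [ffun g => f (g^-1)%g].

Lemma inv_ffun_linear : linear inv_ffun.
Proof. by move=> a f k; apply/ffunP => g; rewrite !ffunE. Qed.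

Lemma fun_alg_hopf : is_hopf (fun_alg F gT).
Proof.
pose S : {linear fun_alg F gT -> fun_alg F gT} :=
  HB.pack (inv_ffun : fun_alg F gT -> fun_alg F gT)
    (GRing.isLinear.Build F (fun_alg F gT) (fun_alg F gT) _ inv_ffun inv_ffun_linear).
have dE (A B : {linear fun_alg F gT -> fun_alg F gT}) (f : fun_alg F gT) z :
    tlift (fun a b => A a * B b) (coprod f) z =
    \sum_g \sum_h f (g * h)%g *
      (A (Defs.fun_delta F g) z * B (Defs.fun_delta F h) z).
  rewrite linear_sum sum_ffunE; apply: eq_bigr => g _.
  rewrite linear_sum sum_ffunE; apply: eq_bigr => h _.
  by rewrite linearZ /= tlift_tens ?ffunE //; apply: bilin_mulr.
(* Only the term with g = z^-1 and h = z contributes. *)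
have E (f : fun_alg F gT) (z : gT) :
    \sum_g \sum_h f (g * h)%g * ((z^-1 == g)%g%:R * (z == h)%:R) = f 1%g.
  rewrite (bigD1 z^-1%g) //= [X in _ + X]big1 ?addr0 => [|g /negPf gz]; last first.
    by rewrite big1 // => h _; rewrite eq_sym gz mul0r mulr0.
  rewrite (bigD1 z) //= big1 ?addr0 => [|h /negPf hz]; last first.
    by rewrite eq_sym hz !mulr0.
  by rewrite !eqxx mulVg !mulr1.
exists S; split=> f; apply/ffunP => z.
  rewrite (dE S idfun) /= !ffunE [RHS]mulr1 -[RHS](E f z).
  by apply: eq_bigr => g _; apply: eq_bigr => h _; rewrite !ffunE.
(* The right antipode identity at z is the same sum taken at z^-1. *)
rewrite (dE idfun S) /= !ffunE [RHS]mulr1 -[RHS](E f z^-1%g).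
by apply: eq_bigr => g _; apply: eq_bigr => h _; rewrite !ffunE invgK.
Qed.

Lemma grp_alg_hopf : is_hopf (grp_alg F gT).
Proof.
pose S : {linear grp_alg F gT -> grp_alg F gT} :=
  HB.pack (inv_ffun : grp_alg F gT -> grp_alg F gT)
    (GRing.isLinear.Build F (grp_alg F gT) (grp_alg F gT) _ inv_ffun inv_ffun_linear).
have SE g : S (grp_delta F g) = grp_delta F g^-1%g.
  by apply/ffunP => z; rewrite !ffunE (canF_eq invgK).
have E (L : {linear tensor (grp_alg F gT) (grp_alg F gT) -> grp_alg F gT}) f :
    (forall g, L (grp_delta F g \ox grp_delta F g) = 1) ->
    L (coprod f) = (counit f : F) *: 1.
  move=> L1; rewrite linear_sum scaler_suml; apply: eq_bigr => g _.
  by rewrite linearZ /= L1.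
have M g h : grp_delta F g * grp_delta F h = grp_delta F (g * h)%g :=
  grp_mul_delta F g h.
exists S; split=> f.
  apply: (E (tlift (fun a b => S a * b))) => g /=.
  by rewrite (tlift_tens _ _ (bilin_mulr S idfun)) SE M mulVg.
apply: (E (tlift (fun a b => a * S b))) => g /=.
by rewrite (tlift_tens _ _ (bilin_mulr idfun S)) SE M mulgV.
Qed.

End Antipodes.

Lemma presents_alg_iso (A : falgType 'F_2) (x y : A) n :
  presents x y (std_table n) -> alg_iso (alg3 n) A.
Proof. by move=> p; have [f bf _] := presents_iso (alg3_presents n) p; exists f. Qed.

(** The group law of ['Z_3] is addition: the neutral element [1%g] is [0], and the ring unit [1] is
    a generator. *)
Definition z1 : 'Z_3 := 1.
Definition z2 : 'Z_3 := -1.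

Lemma Z3_ind (P : 'Z_3 -> Prop) : P 0 -> P z1 -> P z2 -> forall z, P z.
Proof.
move=> P0 P1 P2 z; have: [|| z == 0, z == z1 | z == z2] by case: z => [[|[|[|//]]] ?].
by case/or3P=> /eqP->.
Qed.

Section PointwiseValues.

Variables (F : fieldType) (gT : finGroupType).

Lemma fun_alg_lin3E (a b c : F) (f g h : fun_alg F gT) z :
  (a *: f + b *: g + c *: h) z = a * f z + b * g z + c * h z.
Proof. by rewrite !ffunE. Qed.

Lemma fun_alg_mulE (f g : fun_alg F gT) z : (f * g) z = f z * g z.
Proof. by rewrite ffunE. Qed.

Lemma fun_alg_oneE z : (1 : fun_alg F gT) z = 1.
Proof. by rewrite ffunE. Qed.

Lemma fun_deltaE g z : Defs.fun_delta F g z = (z == g :> gT)%:R.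
Proof. by rewrite ffunE. Qed.

Lemma grp_alg_lin3E (a b c : F) (f g h : grp_alg F gT) z :
  (a *: f + b *: g + c *: h) z = a * f z + b * g z + c * h z.
Proof. by rewrite !ffunE. Qed.

Lemma grp_alg_oneE z : (1 : grp_alg F gT) z = (z == 1%g)%:R.
Proof. by rewrite ffunE. Qed.

Lemma grp_deltaE g z : grp_delta F g z = (z == g :> gT)%:R.
Proof. by rewrite ffunE. Qed.

End PointwiseValues.

Lemma fun_Z3_B : alg_iso (alg3 nB) (fun_alg 'F_2 'Z_3).
Proof.
pose x : fun_alg 'F_2 'Z_3 := Defs.fun_delta 'F_2 z1.
pose y : fun_alg 'F_2 'Z_3 := Defs.fun_delta 'F_2 z2.
have E u z : comb 1 x y u z =
    (u.1.1 (+) (u.1.2 && (z == z1)) (+) (u.2 && (z == z2)))%:R.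
  by rewrite comb_def fun_alg_lin3E fun_alg_oneE !fun_deltaE mulr1 !F2_addb !F2_andb.
apply: (@presents_alg_iso _ x y); apply: presents_products.
(* As x and y vanish at 0, the value at 0 is the coefficient of the constant function 1 and has to
   be removed from the other two values. *)
- exists (fun f : fun_alg 'F_2 'Z_3 =>
    (f 0 != 0, (f z1 != 0) (+) (f 0 != 0), (f z2 != 0) (+) (f 0 != 0))) => [u|f].
    by rewrite !E; case: u => [[[] []] []].
  apply/ffunP => z; rewrite E [RHS]F2_eq; congr (_%:R); move: z.
  by apply: Z3_ind => /=; case: (f 0 != 0) (f z1 != 0) (f z2 != 0) => [] [] [].
all: apply/ffunP => z; rewrite E fun_alg_mulE !fun_deltaE -F2_andb.
all: by congr (_%:R); move: z; apply: Z3_ind.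
Qed.

Lemma grp_Z3_D : alg_iso (alg3 nD) (grp_alg 'F_2 'Z_3).
Proof.
pose d1 : grp_alg 'F_2 'Z_3 := grp_delta 'F_2 z1.
pose d2 : grp_alg 'F_2 'Z_3 := grp_delta 'F_2 z2.
have M g h : grp_delta 'F_2 g * grp_delta 'F_2 h = grp_delta 'F_2 (g * h)%g :=
  grp_mul_delta 'F_2 g h.
have e11 : d1 * d1 = d2 by rewrite M; congr (grp_delta _ _); apply: val_inj.
have e12 : d1 * d2 = 1 by rewrite M; congr (grp_delta _ _); apply: val_inj.
have e21 : d2 * d1 = 1 by rewrite M; congr (grp_delta _ _); apply: val_inj.
have e22 : d2 * d2 = d1 by rewrite M; congr (grp_delta _ _); apply: val_inj.
have dE u z : comb 1 d1 d2 u z =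
    ((u.1.1 && (z == 0)) (+) (u.1.2 && (z == z1)) (+) (u.2 && (z == z2)))%:R.
  by rewrite comb_def grp_alg_lin3E grp_alg_oneE !grp_deltaE !F2_addb !F2_andb.
have b : bijective (comb 1 d1 d2).
  exists (fun f : grp_alg 'F_2 'Z_3 => (f 0 != 0, f z1 != 0, f z2 != 0)) => [u|f].
    by rewrite !dE; case: u => [[[] []] []].
  apply/ffunP => z; rewrite dE [RHS]F2_eq; congr (_%:R); move: z.
  by apply: Z3_ind => /=; case: (f 0 != 0) (f z1 != 0) (f z2 != 0) => [] [] [].
(* The group elements give the table of the group, not that of D; a suitable change of frame, for
   instance to 1 + d1 and 1 + d2, is left to the search in [alg_related]. *)
have p : presents d1 d2 (bvy, bvo, bvo, bvx).
  by apply: presents_products; rewrite ?combE.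
apply: alg_iso_sym.
by apply/(alg_iso_related p (alg3_presents nD)); vm_compute.
Qed.

(** * The field with eight elements *)

Lemma F_table_field : all (fun u => all (fun v =>
    bvmul (std_table nF) u v == bvmul (std_table nF) v u) all_bv
  && ((u == bvz) || has (fun v => bvmul (std_table nF) u v == bvo) all_bv)) all_bv.
Proof. by vm_compute. Qed.

Lemma alg3_F_comm (u v : alg3 nF) : u * v = v * u.
Proof.
have [[c cK Kc] M] := alg3_presents nF.
rewrite -[u]Kc -[v]Kc !M; congr (comb _ _ _ _).
have /allP/(_ _ (mem_all_bv (c u)))/andP[/allP/(_ _ (mem_all_bv (c v)))/eqP C _] :=
  F_table_field.
exact: C.
Qed.

Lemma alg3_F_unit (u : alg3 nF) : u != 0 -> u \is a GRing.unit.
Proof.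
have [[c cK Kc] M] := alg3_presents nF => u0.
have /allP/(_ _ (mem_all_bv (c u)))/andP[_ /orP[/eqP cu|/hasP[w _ /eqP uw]]] :=
  F_table_field.
  by case/eqP: u0; rewrite -[u]Kc cu comb_def /= !scale0r !addr0.
pose v : alg3 nF := comb 1 (vec3 0 1 0 : alg3 nF) (vec3 0 0 1 : alg3 nF) w.
have uv : u * v = 1 by rewrite -[u]Kc M uw comb_o.
by apply/unitrP; exists v; rewrite alg3_F_comm.
Qed.

Lemma fun_Z3_type : of_type (alg3 nB) (alg3 nD) (fun_alg 'F_2 'Z_3).
Proof.
have d3 : \dim {:fun_alg 'F_2 'Z_3} = 3%N.
  by rewrite -(alg_iso_dim fun_Z3_B) dim_alg3.
have /(hopf_type d3)[//|[iD _]] := fun_alg_hopf 'F_2 'Z_3.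
by have /alg3_inj := alg_iso_trans fun_Z3_B iD.
Qed.

Lemma grp_Z3_type : of_type (alg3 nD) (alg3 nB) (grp_alg 'F_2 'Z_3).
Proof.
have d3 : \dim {:grp_alg 'F_2 'Z_3} = 3%N.
  by rewrite -(alg_iso_dim grp_Z3_D) dim_alg3.
have /(hopf_type d3)[[iB _]|//] := grp_alg_hopf 'F_2 'Z_3.
by have /alg3_inj := alg_iso_trans grp_Z3_D iB.
Qed.

Theorem mainTheorem3 :
  (* the parenthetical descriptions of B, D and F *)
  [/\ alg_iso (alg3 nB) (fun_alg 'F_2 'Z_3),
      alg_iso (alg3 nD) (grp_alg 'F_2 'Z_3),
      forall u v : alg3 nF, u * v = v * u
    & forall u : alg3 nF, u != 0 -> u \is a GRing.unit]
  /\
  (* the algebra of a 3-dimensional bialgebra is B, C, D or G *)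
  (forall H : bialgType 'F_2, \dim {:H} = 3%N ->
     [\/ alg_iso H (alg3 nB), alg_iso H (alg3 nC),
         alg_iso H (alg3 nD) | alg_iso H (alg3 nG)])
  /\
  (forall H : bialgType 'F_2,
     [/\ ~ alg_iso H (alg3 nA), ~ alg_iso H (alg3 nE) & ~ alg_iso H (alg3 nF)])
  /\
  (* the number of isomorphism classes of each type *)
  (forall X Y : alg_name,
     num_iso_classes (of_type (alg3 X) (alg3 Y)) (bialg_count X Y))
  /\
  (* no other type (X, Y^* ) occurs, for arbitrary algebras X and Y *)
  (forall (X Y : falgType 'F_2) (H : bialgType 'F_2),
     \dim {:H} = 3%N -> of_type X Y H ->
     exists X' Y' : alg_name,
       [/\ alg_iso X (alg3 X'), alg_iso Y (alg3 Y')
         & (0 < bialg_count X' Y')%N])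
  /\
  (* the Hopf algebras *)
  (forall H : bialgType 'F_2, \dim {:H} = 3%N ->
     (is_hopf H <->
      of_type (alg3 nB) (alg3 nD) H \/ of_type (alg3 nD) (alg3 nB) H))
  /\
  (forall H : bialgType 'F_2,
     of_type (alg3 nB) (alg3 nD) H <-> bialg_iso H (fun_alg 'F_2 'Z_3))
  /\
  (forall H : bialgType 'F_2,
     of_type (alg3 nD) (alg3 nB) H <-> bialg_iso H (grp_alg 'F_2 'Z_3)).
Proof.
have type3 (H : bialgType 'F_2) : \dim {:H} = 3%N ->
    exists X Y, of_type (alg3 X) (alg3 Y) H /\ (0 < bialg_count X Y)%N.
  case/dim3_rep=> X [Y [c Xc Hc]]; exists X, Y.
  by split; [apply: rep_of_type Xc Hc | apply: reps_count Xc].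
split.
  split; [exact: fun_Z3_B | exact: grp_Z3_D | exact: alg3_F_comm | exact: alg3_F_unit].
split.
  move=> H /type3[X [Y [[HX _] pos]]].
  by case: X Y HX pos => [] [] // HX _;
    first [exact: Or41 | exact: Or42 | exact: Or43 | exact: Or44].
split.
  move=> H; have no X : alg_iso H (alg3 X) -> exists Y, (0 < bialg_count X Y)%N.
    move=> HX; have [|X' [Y [[HX' _] pos]]] := type3 H.
      by rewrite (alg_iso_dim HX) dim_alg3.
    by exists Y; rewrite (alg3_inj (alg_iso_trans (alg_iso_sym HX) HX')).
  (* For A, E and F the entries of [bialg_count] are 0 whatever the second index. *)
  by split=> /no[[]].
split; first exact: num_iso_classes_count.
split.
  move=> X Y H /type3[X' [Y' [[HX' HY'] pos]]] [HX HY]; exists X', Y'; split=> //.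
    exact: alg_iso_trans (alg_iso_sym HX) HX'.
  exact: alg_iso_trans (alg_iso_sym HY) HY'.
split; first exact: hopf_type.
split=> H; first exact: bialg_iso_unique fun_Z3_type.
exact: bialg_iso_unique grp_Z3_type.
Qed.
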